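(* For any group $G$, $|L(G)|$ is $(d(G)-3)$-connected. In particular, if $d(G)=\infty$ then $|L(G)|$ is contractible.
   Context: $L(G)$ is the poset of proper nontrivial subgroups of $G$ ordered by inclusion, and $|L(G)|$ the geometric realization of its order complex. $d(G)$ is the length of a chief series of $G$ (a maximal chain $1=N_0\triangleleft N_1\triangleleft\cdots\triangleleft N_d=G$ in the lattice of normal subgroups of $G$, of length $d$), i.e. the rank of the lattice of normal subgroups; $d(G)=\infty$ if $G$ has no chief series. Convention: a space is $(-1)$-connected iff nonempty, every space is $(-2)$-connected, and the empty space is not $0$-connected. *)

(* Defs.v *)
From HB Require Import structures.
From mathcomp Require Import all_boot all_order all_algebra.
From mathcomp Require Import boolp classical_sets functions reals topology normedtype.
From mathcomp Require Import Rstruct Rstruct_topology.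
Import Order.TTheory GRing.Theory Num.Theory.

Set Implicit Arguments.
Unset Strict Implicit.
Unset Printing Implicit Defensive.

Local Open Scope classical_set_scope.
Local Open Scope ring_scope.
Local Notation R := Rdefinitions.R.

Section Groups.
Variables (T : Type) (mul : T -> T -> T) (one : T) (inv : T -> T).

Definition is_group : Prop :=
  [/\ (forall x y z, mul x (mul y z) = mul (mul x y) z),
      (forall x, mul one x = x) &
      (forall x, mul (inv x) x = one)].

Definition subgroup (H : set T) : Prop :=
  [/\ H one, (forall x y, H x -> H y -> H (mul x y)) & (forall x, H x -> H (inv x))].

Definition normal_subgroup (H : set T) : Prop :=
  subgroup H /\ forall g x, H x -> H (mul (mul (inv g) x) g).

Definition proper_nontrivial_subgroup (H : set T) : Prop :=
  [/\ subgroup H, H <> setT & H <> [set one]].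

Definition is_chief_series (d : nat) (N : nat -> set T) : Prop :=
  [/\ N 0%N = [set one], N d = setT,
      (forall i, (i <= d)%N -> normal_subgroup (N i)),
      (forall i, (i < d)%N -> N i `<` N i.+1) &
      (forall i K, (i < d)%N -> normal_subgroup K -> N i `<=` K -> K `<=` N i.+1 ->
         K = N i \/ K = N i.+1)].

(* d(G) = d  (d(G) = infinity iff no such d exists) *)
Definition chief_length (d : nat) : Prop := exists N, is_chief_series d N.

End Groups.

Section Realization.
Variables (P : Type) (V : set P) (lt : P -> P -> Prop).

Definition std_simplex (n : nat) : set 'rV[R]_n :=
  [set t | (forall i, 0 <= t ord0 i) /\ \sum_(i < n) t ord0 i = 1].
Arguments std_simplex n : clear implicits.

Definition is_chain (n : nat) (s : 'I_n -> P) : Prop :=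
  (forall i, V (s i)) /\ (forall i j : 'I_n, (i < j)%N -> lt (s i) (s j)).

(* barycentric point sum_i t_i s_i, as a function P -> R *)
Definition bary (n : nat) (s : 'I_n -> P) (t : 'rV[R]_n) : P -> R :=
  fun p => \sum_(i < n) (if `[< s i = p >] then t ord0 i else 0).

Definition in_realization (a : P -> R) : Prop :=
  exists n (s : 'I_n -> P) (t : 'rV[R]_n),
    [/\ is_chain s, std_simplex n t & a = bary s t].

Definition realization := {a : P -> R | in_realization a}.
HB.instance Definition _ := gen_eqMixin realization.
HB.instance Definition _ := gen_choiceMixin realization.


(* weak topology: U is open iff its preimage in every closed simplex is open *)
Definition realization_open (U : set realization) : Prop :=
  forall n (s : 'I_n -> P), is_chain s ->
    exists O : set 'rV[R]_n, open O /\
      forall t, std_simplex n t -> (O t <-> exists x, U x /\ sval x = bary s t).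

Lemma bary_in n (s : 'I_n -> P) t : is_chain s -> std_simplex n t ->
  in_realization (bary s t).
Proof. by move=> cs st; exists n, s, t. Qed.

Lemma realization_val_inj (x y : realization) : sval x = sval y -> x = y.
Proof.
case: x y => [a ha] [b hb] /= eab; move: ha hb; rewrite eab => ha hb.
by rewrite (Prop_irrelevance ha hb).
Qed.

Lemma realization_openT : realization_open setT.
Proof.
move=> n s cs; exists setT; split; first exact: openT.
move=> t st; split=> // _.
by exists (exist _ (bary s t) (bary_in cs st)).
Qed.

Lemma realization_openI : setI_closed realization_open.
Proof.
move=> U1 U2 o1 o2 n s cs.
have [O1 [oO1 h1]] := o1 n s cs; have [O2 [oO2 h2]] := o2 n s cs.
exists (O1 `&` O2); split; first exact: openI.
move=> t st; split.
- case=> /(h1 t st) [x [Ux ex]] /(h2 t st) [y [Uy ey]].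
  exists x; split=> //; split=> //.
  by have -> : x = y by apply: realization_val_inj; rewrite ex ey.
- case=> x [[U1x U2x] ex]; split.
  + by apply/(h1 t st); exists x.
  + by apply/(h2 t st); exists x.
Qed.

Lemma realization_open_bigU (I : Type) (f : I -> set realization) :
  (forall i, realization_open (f i)) -> realization_open (\bigcup_i f i).
Proof.
move=> ofi n s cs.
have : forall i, exists O : set 'rV[R]_n, open O /\
      forall t, std_simplex n t -> (O t <-> exists x, f i x /\ sval x = bary s t).
  by move=> i; exact: ofi.
move=> /choice [O hO].
exists (\bigcup_i O i); split.
  by apply: bigcup_open => i _; case: (hO i).
move=> t st; split.
- case=> i _ /((hO i).2 t st) [x [fx ex]].
  by exists x; split=> //; exists i.
- case=> x [[i _ fx] ex]; exists i => //.
  by apply/((hO i).2 t st); exists x.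
Qed.

HB.instance Definition _ := isOpenTopological.Build realization
  realization_openT realization_openI realization_open_bigU.

End Realization.

Definition subgroup_complex (T : Type) (mul : T -> T -> T) (one : T) (inv : T -> T)
  : topologicalType :=
  realization (proper_nontrivial_subgroup mul one inv) (fun A B : set T => A `<` B).

(* S^k and D^(k+1), both inside R^(k+1) *)
Definition sphere (k : nat) : set 'rV[R]_k.+1 :=
  [set x | \sum_(i < k.+1) x ord0 i ^+ 2 = 1].
Definition disk (k : nat) : set 'rV[R]_k.+1 :=
  [set x | \sum_(i < k.+1) x ord0 i ^+ 2 <= 1].
Arguments sphere k : clear implicits.
Arguments disk k : clear implicits.

(* X is n-connected (n : int): nonempty if n >= -1 (S^-1 = empty extends
   to D^0 = point), and for 0 <= k <= n every map S^k -> X extends to D^(k+1).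
   For n <= -2 this is trivially true. *)
Definition n_connected (X : topologicalType) (n : int) : Prop :=
  ((-1 <= n)%R -> exists x : X, True) /\
  forall k : nat, (k%:Z <= n)%R ->
    forall f : 'rV[R]_k.+1 -> X, {within sphere k, continuous f} ->
      exists g : 'rV[R]_k.+1 -> X,
        {within disk k, continuous g} /\ (forall x, sphere k x -> g x = f x).

Definition contractible (X : topologicalType) : Prop :=
  exists (x0 : X) (H : X * R -> X),
    [/\ {within [set p : X * R | 0 <= p.2 <= 1], continuous H},
        (forall x, H (x, 0) = x) & (forall x, H (x, 1) = x0)].

(* Main.v *)
(* A chain M_1 < ... < M_e of proper nontrivial normal subgroups makes |L(G)|
   (e-2)-connected. To run an induction, consider for a subgroup Y the poset of
   subgroups 1 < H < Y together with some sets above Y, and put N = M_1. The H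
   with HN <> Y form a contractible part J (H <= HN >= N). The remaining H, finitely
   many for a given map from a sphere, are added back from the top down: the link
   of such an H consists of the K in J below H and of elements above H. It is
   contractible by K <= K(H /\ N) >= H /\ N if H meets N nontrivially; otherwise
   it has the same form as before, with H in place of Y, and the M_i /\ H for i > 1
   form a chain of length e - 1.

   Connectivity is handled without simplicial approximation: maps are given by
   continuous barycentric coordinates and are extended cell by cell over cubical
   grids, which shows that adding a vertex with an (n-2)-connected link preserves
   (n-1)-connectedness. If d(G) is infinite there are normal chains of any length,
   and the same cell by cell extension over |L(G)| x [0, 1] gives a contraction. *)
Require Import Defs.
From HB Require Import structures.
From mathcomp Require Import all_boot all_order all_algebra.
From mathcomp Require Import mathcomp_extra boolp classical_sets functions cardinality.
From mathcomp Require Import reals topology normedtype.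
From mathcomp Require Import Rstruct Rstruct_topology.
From mathcomp Require realfun.
From mathcomp Require Import lra zify.
Import Order.TTheory GRing.Theory Num.Theory.
Import numFieldNormedType.Exports.
Set Implicit Arguments.
Unset Strict Implicit.
Unset Printing Implicit Defensive.
Local Open Scope classical_set_scope.
Local Open Scope ring_scope.

(** The obstacle is that [G] may be infinite: [L(G)] has no dimension bound and its order need not
    be well-founded. [Ext V n], the extension of tame maps from the boundary of the [n]-cube,
    involves only finitely many vertices at a time, so an order for adding vertices is chosen on
    finite sets only. Passing to a link lowers the index by one; in the complemented case the chain
    of normal subgroups loses one term as well, so the two stay in balance. Sets above [Y] are
    carried along because the link of [H] contains the previously added elements above [H]; each of
    them contains [N], so the contraction can fix them. Cubes are used throughout because a product
    with an interval or a finer grid is again made of cubes: a simplex rescaled to maximal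
    coordinate 2 becomes a union of faces of a cube, and one lemma, [grid_extension], serves both
    the addition of a vertex and the contraction. *)

Section ContinuityOnSets.
Variable R : realType.
Implicit Types E U W : topologicalType.

(** Unfolds [{within A, continuous f}] to the ambient neighbourhood filter, so that limit lemmas
    apply directly. *)
Definition ctn E U (A : set E) (f : E -> U) : Prop :=
  forall x, A x -> f @ within A (nbhs x) --> f x.

Lemma ctnP E U (A : set E) (f : E -> U) :
  ctn A f <-> {within A, continuous f}.
Proof. by split=> /subspace_continuousP. Qed.

Lemma continuous_ctn E U (A : set E) (f : E -> U) : continuous f -> ctn A f.
Proof. by move=> cf; apply/ctnP; exact: continuous_subspaceT. Qed.

Lemma ctnT_continuous E U (f : E -> U) : ctn setT f -> continuous f.
Proof.
move=> cf x S nS; have := cf x Logic.I S nS; rewrite /within /fmap /= => hS.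
by apply: (@filterS _ (nbhs x) _ _ _ _ hS) => y /= h; exact: h.
Qed.

Lemma ctn_sub E U (A B : set E) (f : E -> U) :
  A `<=` B -> ctn B f -> ctn A f.
Proof. by move=> AB cf; apply/ctnP/(continuous_subspaceW AB)/ctnP. Qed.

Lemma ctn_eq E U (A : set E) (f g : E -> U) :
  (forall x, A x -> f x = g x) -> ctn A f -> ctn A g.
Proof.
move=> fg cf x Ax S; rewrite -fg // => /(cf x Ax) fS.
apply: (@filterS _ (nbhs x) _ _ _ _ fS) => y /= h Ay.
by rewrite -fg //; exact: h.
Qed.

Lemma ctn_comp E U W (A : set E) (B : set U) (h : E -> U) (f : U -> W) :
  ctn A h -> (forall x, A x -> B (h x)) -> ctn B f ->
  ctn A (fun x => f (h x)).
Proof.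
move=> ch AB cf x Ax S /(cf _ (AB _ Ax)).
rewrite /within /fmap /= => /(ch x Ax) hS.
by apply: (@filterS _ (nbhs x) _ _ _ _ hS) => y /= h1 Ay; exact: h1 (AB _ Ay).
Qed.

Lemma ctnU E U (A B : set E) (f : E -> U) :
  closed A -> closed B -> ctn A f -> ctn B f -> ctn (A `|` B) f.
Proof. by move=> cA cB /ctnP fA /ctnP fB; apply/ctnP; exact: withinU_continuous. Qed.

Lemma ctn_cst E U (A : set E) (a : U) : ctn A (fun=> a).
Proof. by move=> x _; exact: cvg_cst. Qed.

Lemma ctnD E (A : set E) (f g : E -> R) :
  ctn A f -> ctn A g -> ctn A (fun x => f x + g x).
Proof. by move=> cf cg x Ax; exact: cvgD (cf x Ax) (cg x Ax). Qed.

Lemma ctnN E (A : set E) (f : E -> R) : ctn A f -> ctn A (fun x => - f x).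
Proof. by move=> cf x Ax; exact: cvgN (cf x Ax). Qed.

Lemma ctnM E (A : set E) (f g : E -> R) :
  ctn A f -> ctn A g -> ctn A (fun x => f x * g x).
Proof. by move=> cf cg x Ax; exact: cvgM (cf x Ax) (cg x Ax). Qed.

Lemma ctnV E (A : set E) (f : E -> R) :
  (forall x, A x -> f x != 0) -> ctn A f -> ctn A (fun x => (f x)^-1).
Proof. by move=> f0 cf x Ax; exact: cvgV (f0 x Ax) (cf x Ax). Qed.

Lemma ctn_abs E (A : set E) (f : E -> R) : ctn A f -> ctn A (fun x => `|f x|).
Proof. by move=> cf x Ax; exact: cvg_norm (cf x Ax). Qed.

Lemma ctn_sum E (A : set E) (I : Type) (s : seq I) (Q : pred I)
    (f : I -> E -> R) :
  (forall i, Q i -> ctn A (f i)) -> ctn A (fun x => \sum_(i <- s | Q i) f i x).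
Proof.
move=> cf; elim: s => [|i s IH].
  by apply: (@ctn_eq _ _ _ (fun=> 0)) => [x _|]; [by rewrite big_nil|exact: ctn_cst].
apply: (@ctn_eq _ _ _ (fun x => (if Q i then f i x else 0) +
                             \sum_(j <- s | Q j) f j x)).
  by move=> x _; rewrite big_cons; case: (Q i); rewrite ?add0r.
by apply: ctnD => //; case Qi: (Q i); [exact: cf|exact: ctn_cst].
Qed.

(** The positive part max(a, 0), written with the norm so that continuity is inherited. *)
Definition pos (a : R) : R := (a + `|a|) / 2.

Lemma pos_ge0 a : 0 <= pos a.
Proof. by rewrite /pos; have := ler_norm (- a); rewrite normrN; lra. Qed.

Lemma pos_le0 a : a <= 0 -> pos a = 0.
Proof. by move=> a0; rewrite /pos ler0_norm //; lra. Qed.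

Lemma pos_gt0 a : 0 < a -> pos a = a.
Proof. by move=> a0; rewrite /pos gtr0_norm //; lra. Qed.

Lemma ctn_pos E (A : set E) (f : E -> R) :
  ctn A f -> ctn A (fun x => pos (f x)).
Proof.
by move=> cf; apply: ctnM; [apply: ctnD => //; exact: ctn_abs|exact: ctn_cst].
Qed.

Lemma ctn_rV E n (A : set E) (f : E -> 'rV[R]_n) :
  (forall j, ctn A (fun x => f x ord0 j)) -> ctn A f.
Proof.
move=> cf x Ax S [B nB BS].
have nbS : \forall y \near within A (nbhs x), forall j, B ord0 j (f y ord0 j).
  apply: (@filter_forall _ _ _ _ (within_filter _ _)) => j.
  exact: (cf j x Ax _ (nB ord0 j)).
apply: (@filterS _ (nbhs x) _ _ _ _ nbS) => y /= h Ay.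
by apply: BS => i j; rewrite ord1; exact: h.
Qed.

Lemma ctn_coord n (A : set 'rV[R]_n) j : ctn A (fun x => x ord0 j).
Proof. by apply: continuous_ctn; exact: coord_continuous. Qed.

(** The product topology is the supremum of the topologies induced by the projections, so
    convergence is tested one coordinate at a time; [I] may be infinite. *)
Lemma ctn_ptws E (I : choiceType) (A : set E) (f : E -> {ptws I -> R}) :
  (forall i, ctn A (fun x => f x i)) -> ctn A f.
Proof.
move=> cf x Ax; apply/cvg_sup => i.
have surj : @proj I (fun=> R) i @` setT = setT.
  by apply/seteqP; split=> // a _; exists (fun=> a).
have FF : Filter (f @ within A (nbhs x)) by exact: fmap_filter.
apply/(@cvg_image _ _ _ (f @ within A (nbhs x)) (f x) FF surj) => B nB.
have h := cf i x Ax _ nB.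
exists (@proj I (fun=> R) i @^-1` B); first exact: h.
by rewrite image_preimage.
Qed.

Lemma ctn_ptws_coord (I : choiceType) (A : set {ptws I -> R}) i :
  ctn A (fun x : {ptws I -> R} => x i).
Proof.
by apply: continuous_ctn; exact: (@proj_continuous I (fun=> R) i).
Qed.

Lemma closed_le E (f g : E -> R) :
  continuous f -> continuous g -> closed [set x | f x <= g x].
Proof.
move=> cf cg.
have -> : [set x | f x <= g x] = (fun x => g x - f x) @^-1` [set y | 0 <= y].
  by apply/seteqP; split=> x /=; rewrite subr_ge0.
apply: closed_comp => [x _|]; last exact: closed_ge.
by apply: cvgB; [exact: cg|exact: cf].
Qed.

End ContinuityOnSets.

(** * Maps to flag complexes and the extension property *)

Section TameMaps.
Variables (R : realType) (P : choiceType) (adj : P -> P -> Prop).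
Hypotheses (adj_refl : forall p, adj p p) (adj_sym : forall p q, adj p q -> adj q p).
Implicit Types (V W : set P) (a b : P -> R).

(** The support is a clique; its finiteness is imposed in [tame], uniformly over the domain. *)
Definition pt V a : Prop :=
  [/\ forall p, 0 <= a p, forall p, a p != 0 -> V p,
      forall p q, a p != 0 -> a q != 0 -> adj p q & exists p, a p != 0].

(** If the two supports are cliques, then so is their union, and the segment between the two points
    stays in the complex. *)
Definition joined a b : Prop := forall p q, a p != 0 -> b q != 0 -> adj p q.

(* A map to the realization of the flag complex of [adj] on [V], inside a finite
   subcomplex; barycentric coordinates are only required up to a common positive
   factor, which spares all renormalizations. *)
Definition tame (E : topologicalType) V (A : set E) (phi : E -> P -> R) : Prop :=
  [/\ forall x, A x -> pt V (phi x),
      exists F : seq P, forall x p, A x -> phi x p != 0 -> p \in F &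
      forall p, ctn A (fun x => phi x p)].

Lemma pt_sub V W a : (forall p, a p != 0 -> V p -> W p) -> pt V a -> pt W a.
Proof. by move=> VW [a0 aV ac an]; split=> // p ap; apply: VW => //; exact: aV. Qed.

Lemma tame_sub (E : topologicalType) V W (A B : set E) phi :
  V `<=` W -> A `<=` B -> tame V B phi -> tame W A phi.
Proof.
move=> VW AB [h1 [F hF] h3]; split=> [x Ax||p].
- by apply: (pt_sub (V := V)) => [p _|]; [exact: VW|exact: h1 (AB _ Ax)].
- by exists F => x p /AB; exact: hF.
- exact: ctn_sub (h3 p).
Qed.

Lemma tame_eq (E : topologicalType) V (A : set E) phi psi :
  (forall x, A x -> phi x = psi x) -> tame V A phi -> tame V A psi.
Proof.
move=> e [h1 [F hF] h3]; split=> [x Ax||p].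
- by rewrite -e //; exact: h1.
- by exists F => x p Ax; rewrite -e //; exact: hF.
- by apply: ctn_eq (h3 p) => x Ax; rewrite e.
Qed.

Lemma tame_comp (E E' : topologicalType) V (A : set E) (B : set E')
    (h : E -> E') phi :
  ctn A h -> (forall x, A x -> B (h x)) -> tame V B phi ->
  tame V A (fun x => phi (h x)).
Proof.
move=> ch AB [h1 [F hF] h3]; split=> [x Ax||p].
- exact: h1 (AB _ Ax).
- by exists F => x p /AB; exact: hF.
- exact: ctn_comp ch AB (h3 p).
Qed.

Lemma tame_setU (E : topologicalType) V (A B : set E) phi :
  closed A -> closed B -> tame V A phi -> tame V B phi -> tame V (A `|` B) phi.
Proof.
move=> cA cB [h1 [F hF] h3] [k1 [G kG] k3]; split=> [x [/h1|/k1] //||p].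
  exists (F ++ G) => x p [/hF h /h|/kG h /h]; rewrite mem_cat => -> //.
  by rewrite orbT.
by apply: ctnU.
Qed.

Lemma tame_set0 (E : topologicalType) V phi : tame V (@set0 E) phi.
Proof. by split=> [x []||p x []]; exists [::] => x p []. Qed.

Lemma tame_bigU (E : topologicalType) (I : eqType) V (s : seq I) (A : I -> set E) phi :
  (forall i, i \in s -> closed (A i)) ->
  (forall i, i \in s -> tame V (A i) phi) ->
  closed [set x | exists2 i, i \in s & A i x] /\
  tame V [set x | exists2 i, i \in s & A i x] phi.
Proof.
elim: s => [|i s IH] cA tA.
  have -> : [set x | exists2 i, i \in [::] & A i x] = set0.
    by apply/seteqP; split=> x // [].
  by split; [exact: closed0|exact: tame_set0].
have -> : [set x | exists2 j, j \in i :: s & A j x] =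
          A i `|` [set x | exists2 j, j \in s & A j x].
  apply/seteqP; split=> x /=.
    move=> [j]; rewrite inE => /orP[/eqP-> |js] Ax; [by left|].
    by right; exists j.
  by move=> [Ax|[j js Ax]]; [exists i|exists j] => //; rewrite inE ?eqxx ?js ?orbT.
have [||c t] := IH.
- by move=> j js; apply: cA; rewrite inE js orbT.
- by move=> j js; apply: tA; rewrite inE js orbT.
have ii : i \in i :: s by rewrite inE eqxx.
split; [by apply: closedU => //; exact: cA|by apply: tame_setU => //; first [exact: cA|exact: tA]].
Qed.

Lemma tame_add (E : topologicalType) V (A : set E) phi psi (l m : E -> R) :
  tame V A phi -> tame V A psi -> (forall x, A x -> joined (phi x) (psi x)) ->
  ctn A l -> ctn A m -> (forall x, A x -> 0 <= l x /\ 0 <= m x) ->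
  (forall x, A x -> 0 < l x + m x) ->
  tame V A (fun x p => l x * phi x p + m x * psi x p).
Proof.
move=> [h1 [F hF] h3] [k1 [G kG] k3] jn cl cm lm0 lm.
have spl x p : l x * phi x p + m x * psi x p != 0 ->
    phi x p != 0 \/ psi x p != 0.
  move=> h; have [e|] := eqVneq (phi x p) 0; last by left.
  by right; apply: contraNneq h => ->; rewrite e !mulr0 addr0.
split=> [x Ax||p].
- have [f0 fV fc [p0 fp0]] := h1 x Ax; have [g0 gV gc [q0 gq0]] := k1 x Ax.
  have [l0 m0] := lm0 x Ax; split.
  + by move=> p; rewrite addr_ge0 // mulr_ge0.
  + by move=> p /spl[/fV|/gV].
  + move=> p q /spl[hp|hp] /spl[hq|hq]; [exact: fc|exact: (jn x Ax)| |exact: gc].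
    by apply: adj_sym; exact: (jn x Ax).
  + have pp : 0 < phi x p0 by rewrite lt_def fp0 f0.
    have qq : 0 < psi x q0 by rewrite lt_def gq0 g0.
    have [le0|lgt0] := leP (l x) 0.
      exists q0; rewrite gt_eqF // ltr_wpDl ?mulr_ge0 // mulr_gt0 //.
      by have := lm x Ax; lra.
    by exists p0; rewrite gt_eqF // ltr_wpDr ?mulr_ge0 // mulr_gt0.
- exists (F ++ G) => x p Ax /spl[/(hF _ _ Ax)|/(kG _ _ Ax)]; rewrite mem_cat => -> //.
  by rewrite orbT.
- by apply: ctnD; apply: ctnM.
Qed.

Definition delta (c p : P) : R := (p == c)%:R.

Lemma delta_neq0 c p : delta c p != 0 -> p = c.
Proof. by rewrite /delta; case: (p == c) (@eqP _ p c) => [[]|_] //=; rewrite eqxx. Qed.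

Lemma tame_delta (E : topologicalType) V (A : set E) c :
  V c -> tame V A (fun=> delta c).
Proof.
have dn0 := @delta_neq0 c.
move=> Vc; split=> [x _||p]; last exact: ctn_cst.
- split.
  + by move=> p; rewrite /delta ler0n.
  + by move=> p /dn0->.
  + by move=> p q /dn0-> /dn0->.
  + by exists c; rewrite /delta eqxx oner_eq0.
- by exists [:: c] => x p _ /dn0->; rewrite inE.
Qed.

(** The norm of row vectors is the sup norm, so the unit ball is a cube. For [n = 0] it is a point
    with empty boundary, which makes [Ext V 0] say that [V] is nonempty. *)
Definition cube n : set 'rV[R]_n := [set x | `|x| <= 1].
Definition bdry n : set 'rV[R]_n := [set x | `|x| = 1].
Arguments cube n : clear implicits.
Arguments bdry n : clear implicits.

Definition extends n V (phi : 'rV[R]_n -> P -> R) : Prop :=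
  exists2 g, tame V (cube n) g & forall x, bdry n x -> g x = phi x.

(* The realization of the flag complex on V is (n-1)-connected iff [Ext V m]
   holds for all m <= n. *)
Definition Ext V n : Prop := forall phi, tame V (bdry n) phi -> extends V phi.

Lemma closed_norm_le n (c : R) : closed [set x : 'rV[R]_n | `|x| <= c].
Proof.
apply: (@closed_le R 'rV[R]_n (fun x => `|x|) (fun=> c)).
  exact: norm_continuous.
exact: cst_continuous.
Qed.

Lemma closed_norm_ge n (c : R) : closed [set x : 'rV[R]_n | c <= `|x|].
Proof.
apply: (@closed_le R 'rV[R]_n (fun=> c) (fun x => `|x|)).
  exact: cst_continuous.
exact: norm_continuous.
Qed.

Lemma ctn_norm n (A : set 'rV[R]_n) : ctn A (fun x => `|x|).
Proof. by apply: continuous_ctn; exact: norm_continuous. Qed.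

Lemma ctn_scale n (A : set 'rV[R]_n) (l : 'rV[R]_n -> R) :
  ctn A l -> ctn A (fun x => l x *: x).
Proof.
move=> cl; apply: ctn_rV => j.
apply: (@ctn_eq _ _ _ (fun x : 'rV[R]_n => l x * x ord0 j)) => [x _|].
  by rewrite mxE.
by apply: ctnM => //; exact: ctn_coord.
Qed.

(* [psi] is extended over the inner half of the cube, the shell is used for a
   straight line homotopy from [phi] to [psi]. *)
Lemma extends_joined n V phi psi :
  tame V (bdry n) phi -> tame V (bdry n) psi ->
  (forall x, bdry n x -> joined (phi x) (psi x)) ->
  extends V psi -> extends V phi.
Proof.
move=> tp tq jn [g tg gE].
(* The weights are [(0, 1)] at [|x| = 1/2], where [psi (x / |x|)] equals [g (2x)], and [(1, 0)] at
   [|x| = 1]. For [n = 0] only the inner half occurs. *)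
pose out (x : 'rV[R]_n) p := (2 * `|x| - 1) * phi (`|x|^-1 *: x) p +
                             (2 - 2 * `|x|) * psi (`|x|^-1 *: x) p.
pose G (x : 'rV[R]_n) : P -> R := if `|x| <= 1 / 2 then g (2 *: x) else out x.
pose A1 := [set x : 'rV[R]_n | `|x| <= 1 / 2].
pose A2 := [set x : 'rV[R]_n | 1 / 2 <= `|x|] `&` cube n.
have bd x : A2 x -> bdry n (`|x|^-1 *: x).
  move=> [/= x2 _]; rewrite /bdry /= normrZ normfV normr_id mulVf //.
  by rewrite gt_eqF //; lra.
have bds : ctn A2 (fun x : 'rV[R]_n => `|x|^-1 *: x).
  apply: ctn_scale; apply: ctnV; last exact: ctn_norm.
  by move=> x [/= x2 _]; rewrite gt_eqF //; lra.
exists G; last first.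
  move=> x; rewrite /bdry /= => x1; rewrite /G x1 ifF; last by apply/negP; lra.
  apply/funext => p; rewrite /out x1 invr1 scale1r; lra.
have -> : cube n = A1 `|` A2.
  apply/seteqP; split=> x; rewrite /A1 /A2 /cube /=.
    by move=> x1; have [h|h] := leP `|x| (1/2); [left|right; split=> //; exact: ltW].
  by move=> [h|[]//]; lra.
apply: tame_setU.
- exact: closed_norm_le.
- by apply: closedI; [exact: closed_norm_ge|exact: closed_norm_le].
- apply: (tame_eq (phi := fun x : 'rV[R]_n => g (2 *: x))).
    by move=> x; rewrite /A1 /G /= => ->.
  apply: (tame_comp (B := cube n)) => //.
    by apply: ctn_scale; exact: ctn_cst.
  by move=> x; rewrite /A1 /cube /= normrZ gtr0_norm //; lra.
- apply: (tame_eq (phi := out)).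
    move=> x A2x; rewrite /G; case: ifPn => // x2.
    have x12 : `|x| = 1 / 2 by case: A2x => /= + _; lra.
    have e : `|x|^-1 *: x = 2 *: x by rewrite x12; congr (_ *: _); lra.
    rewrite gE -?e; last exact: bd.
    by apply/funext => p; rewrite /out x12; lra.
  apply: tame_add.
  + exact: tame_comp bds bd tp.
  + exact: tame_comp bds bd tq.
  + by move=> x /bd; exact: jn.
  + by apply: ctnD; [apply: ctnM; [exact: ctn_cst|exact: ctn_norm]|exact: ctn_cst].
  + apply: ctnD; [exact: ctn_cst|apply: ctnN].
    by apply: ctnM; [exact: ctn_cst|exact: ctn_norm].
  + by move=> x [/= x2]; rewrite /cube /=; lra.
  + by move=> x _; lra.
Qed.

(** The constant map to the cone point is joined to every map and extends as a constant. *)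
Lemma Ext_cone V c n : V c -> (forall p, V p -> adj c p) -> Ext V n.
Proof.
move=> Vc hc phi tp; apply: (extends_joined (psi := fun=> delta c)) => //.
- exact: tame_delta.
- move=> x bx p q fp /delta_neq0->.
  by apply/adj_sym/hc; have [/(_ x bx)[_ + _ _] _ _] := tp; apply.
- by exists (fun=> delta c) => //; exact: tame_delta.
Qed.

End TameMaps.
Arguments cube {R} n.
Arguments bdry {R} n.

(** * The sup norm in coordinates *)

Section VectorNorm.
Variables (R : realType) (n : nat).
Implicit Types x : 'rV[R]_n.

Lemma norm_rV_leP x (a : R) : 0 <= a ->
  reflect (forall j, `|x ord0 j| <= a) (`|x| <= a).
Proof.
move=> a0; rewrite [`|x|]/Num.norm /= mx_normrE.
apply: (iffP (bigmax_leP _ _ _ _)) => [[_ h] j|h]; first exact: (h (ord0, j)).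
by split=> // [[i j]] _; rewrite ord1; exact: h.
Qed.

Lemma norm_coord_le x j : `|x ord0 j| <= `|x|.
Proof. by apply/norm_rV_leP. Qed.

Lemma bdryP x : bdry n x <-> (forall j, `|x ord0 j| <= 1) /\ exists j, `|x ord0 j| = 1.
Proof.
split=> [bx|[le1 [j xj]]]; last first.
  rewrite /bdry /=; apply/eqP; rewrite eq_le; apply/andP; split.
    exact/norm_rV_leP.
  by rewrite -xj norm_coord_le.
have le1 : forall j, `|x ord0 j| <= 1 by apply/norm_rV_leP => //; rewrite (bx : _ = _).
split=> //; have [[i j] e] : exists i, mx_norm x = `|x i.1 i.2|.
  by apply: mx_norm_neq0; rewrite -[mx_norm x]/(`|x|) bx oner_neq0.
exists j; transitivity (mx_norm x); last exact: bx.
by rewrite e /= (ord1 i).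
Qed.

End VectorNorm.

(** * Cubical cells in a product of lines *)

Section Grid.
Variables (R : realType) (P : choiceType) (adj : P -> P -> Prop) (I : choiceType).
Local Notation tame := (tame (R := R) adj).
Local Notation Ext := (Ext R adj).
Local Notation pnt := {ptws I -> R}.
Implicit Types (c : I -> nat) (z : pnt).

(* A code c stands for the product of the points {c i} (c i even) and of the
   intervals [c i - 1, c i + 1] (c i odd). *)
Definition cell c : set pnt :=
  [set z | forall i, `|z i - (c i)%:R| <= (odd (c i))%:R].

(** An interval may shrink to one of its end points. An odd number is positive, so [.-1] is a true
    predecessor. *)
Definition face c' c : Prop :=
  forall i, c' i = c i \/ odd (c i) /\ (c' i = (c i).-1 \/ c' i = (c i).+1).

Definition odds c (s : seq I) : Prop := uniq s /\ forall i, (i \in s) = odd (c i).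

(** The index set may be infinite (the prism is indexed by [option P]); a cell is a
    finite-dimensional cube when finitely many coordinates are intervals. *)
Definition fin_code c : Prop := exists s, odds c s.

Definition oddseq c : seq I := xget [::] [set s | odds c s].

Definition dim c : nat := size (oddseq c).

Definition open_cell c : set pnt :=
  [set z | cell c z /\ forall i, odd (c i) -> `|z i - (c i)%:R| < 1].

Definition cell_bd c : set pnt :=
  [set z | cell c z /\ exists2 i, odd (c i) & `|z i - (c i)%:R| = 1].

Lemma oddseqP c : fin_code c -> odds c (oddseq c).
Proof. by move=> [s os]; rewrite /oddseq; case: xgetP => [t _ //|/(_ s)]. Qed.

Lemma cell_face c' c : face c' c -> cell c' `<=` cell c.
Proof.
move=> fc z zc i; have := zc i; have [->//|[oc [->|->]]] := fc i; rewrite oc.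
  case: (c i) oc => // k; rewrite /= => /negbTE -> h.
  have {h} h : z i = k%:R by apply/eqP; rewrite -subr_eq0 -normr_le0.
  by rewrite h -natr1 opprD addrA subrr add0r normrN normr1.
rewrite /= oc /= => h.
have {h} h : z i = (c i).+1%:R by apply/eqP; rewrite -subr_eq0 -normr_le0.
by rewrite h -natr1 addrAC subrr add0r normr1.
Qed.

Lemma face_odd c' c i : face c' c -> odd (c' i) -> odd (c i).
Proof. by move=> fc; have [->|[]] := fc i. Qed.

Lemma face_fin c' c : fin_code c -> face c' c -> fin_code c'.
Proof.
move=> [s [us hs]] fc; exists [seq i <- s | odd (c' i)]; split.
  exact: filter_uniq.
move=> i; rewrite mem_filter hs.
by case o : (odd (c' i)) => //=; exact: face_odd o.
Qed.

Lemma face_dim c' c : fin_code c -> face c' c -> (dim c' <= dim c)%N.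
Proof.
move=> fin fc; have [_ h] := oddseqP fin.
have [u' h'] := oddseqP (face_fin fin fc).
by apply: uniq_leq_size => // i; rewrite h' h; exact: face_odd.
Qed.

Lemma face_dim_lt c' c : fin_code c -> face c' c -> c' <> c -> (dim c' < dim c)%N.
Proof.
move=> fin fc ne; have [_ h] := oddseqP fin.
have [u' h'] := oddseqP (face_fin fin fc).
have [i nei] : exists i, c' i <> c i.
  by apply: contrapT => /forallNP e; apply: ne; apply/funext => i; apply: contrapT; exact: e.
have [oc oc'] : odd (c i) /\ odd (c' i) = false.
  case: (fc i) => // [[oc [->|->]]]; split=> //=; last by rewrite oc.
  by case: (c i) oc => //= k /negbTE.
apply: (@uniq_leq_size _ (i :: oddseq c')) => [|j].
  by rewrite /= h' oc' u'.
by rewrite inE h => /orP[/eqP->//|]; rewrite h'; exact: face_odd.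
Qed.

(** Each interval coordinate in which [z] sits at an end point is replaced by that end point. *)
Lemma open_cell_exists c z : cell c z -> exists2 c', face c' c & open_cell c' z.
Proof.
move=> zc; pose c' i := if odd (c i) && (z i == (c i).+1%:R) then (c i).+1 else
  if odd (c i) && (z i == (c i).-1%:R) then (c i).-1 else c i.
have c'P i : [\/ c' i = c i /\ (odd (c i) -> `|z i - (c i)%:R| < 1),
    [/\ odd (c i), c' i = (c i).+1 & z i = (c i).+1%:R] |
    [/\ odd (c i), c' i = (c i).-1 & z i = (c i).-1%:R]].
  have := zc i; rewrite /c'; case oc : (odd (c i)) => /= h; last by constructor 1.
  case: eqP => e1; first by constructor 2.
  case: eqP => e2; first by constructor 3.
  constructor 1; split=> // _; rewrite lt_def h andbT eq_sym.
  apply/eqP => e; have /orP[/eqP h1|/eqP h1] : (z i - (c i)%:R == 1) || (z i - (c i)%:R == - 1).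
  + by rewrite -eqr_norm2 normr1 e.
  + by apply: e1; rewrite -natr1; lra.
  + apply: e2; case: (c i) oc h1 => // k _; rewrite /= -natr1; lra.
exists c' => [i|].
  case: (c'P i) => [[-> _]|[o -> _]|[o -> _]]; first by left.
    by right; split=> //; right.
  by right; split=> //; left.
split=> i; case: (c'P i) => [[-> h]|[oc -> zi]|[oc -> zi]] //.
- by rewrite zi subrr normr0 ler0n.
- by rewrite zi subrr normr0 ler0n.
- by rewrite /= oc.
- by case: (c i) oc => //= k /negbTE->.
Qed.

(** In each coordinate an even code is the value of [z] itself and an odd code is the only odd
    number at distance less than 1; the two cases exclude each other. So [z] determines its code,
    and a map may be defined on open cells independently. *)
Lemma open_cell_inj c c' z : open_cell c z -> open_cell c' z -> c = c'.
Proof.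
move=> [zc oc] [zc' oc']; apply/funext => i.
have := zc i; have := zc' i; have := oc i; have := oc' i.
case o : (odd (c i)); case o' : (odd (c' i)) => /= h1 h2 h3 h4.
- have := h1 isT; have := h2 isT; rewrite !ltr_norml => /andP[a1 a2] /andP[b1 b2].
  have l1 : (c i < (c' i).+2)%N by rewrite -(ltr_nat R) -!natr1; lra.
  have l2 : (c' i < (c i).+2)%N by rewrite -(ltr_nat R) -!natr1; lra.
  have : (c i == c' i) || (c i == (c' i).+1) || (c' i == (c i).+1) by lia.
  by move=> /orP[/orP[/eqP//|/eqP e]|/eqP e]; move: o o'; rewrite e /=; case: (odd _).
- have := h2 isT; rewrite !ltr_norml => /andP[a1 a2].
  move: h3; rewrite normr_le0 subr_eq0 => /eqP e.
  have l1 : (c i < (c' i).+1)%N by rewrite -(ltr_nat R) -!natr1; lra.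
  have l2 : (c' i < (c i).+1)%N by rewrite -(ltr_nat R) -!natr1; lra.
  lia.
- have := h1 isT; rewrite !ltr_norml => /andP[a1 a2].
  move: h4; rewrite normr_le0 subr_eq0 => /eqP e.
  have l1 : (c i < (c' i).+1)%N by rewrite -(ltr_nat R) -!natr1; lra.
  have l2 : (c' i < (c i).+1)%N by rewrite -(ltr_nat R) -!natr1; lra.
  lia.
- move: h3 h4; rewrite !normr_le0 !subr_eq0 => /eqP-> /eqP e.
  by apply/esym/eqP; rewrite -(eqr_nat R) e.
Qed.

Definition upd c i k : I -> nat := fun j => if j == i then k else c j.

Lemma upd_face c i k : odd (c i) -> k = (c i).-1 \/ k = (c i).+1 -> face (upd c i k) c.
Proof.
move=> o h j; rewrite /upd; case: eqP => [->|_]; last by left.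
by right; split.
Qed.

(** Facets are finitely many for a finite code, so this is the form in which tameness on the
    boundary can be glued. *)
Lemma cell_bdP c z : cell_bd c z <-> exists2 i, odd (c i) &
  cell (upd c i (c i).-1) z \/ cell (upd c i (c i).+1) z.
Proof.
split.
  move=> [zc [i o /eqP e]]; exists i => //.
  move: e; rewrite -[X in _ == X]normr1 eqr_norm2 => /orP[] /eqP e; [right|left] => j;
    rewrite /upd; (case: eqVneq => [->|_]; last exact: zc).
    suff -> : z i = (c i).+1%:R by rewrite subrr normr0 ler0n.
    by rewrite -natr1; lra.
  suff -> : z i = (c i).-1%:R by rewrite subrr normr0 ler0n.
  by case: (c i) o e => // k _; rewrite /= -natr1; lra.
move=> [i o h]; split.
  by case: h; apply: cell_face; apply: upd_face => //; [left|right].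
exists i => //; case: h => /(_ i); rewrite /upd eqxx.
  case: (c i) o => // k; rewrite /= => /negbTE ->; rewrite normr_le0 subr_eq0 => /eqP->.
  by rewrite -natr1 opprD addrA subrr add0r normrN normr1.
rewrite /= o normr_le0 subr_eq0 => /eqP->.
by rewrite -natr1 addrAC subrr add0r normr1.
Qed.

Lemma closed_cell c : closed (cell c).
Proof.
have -> : cell c = \bigcap_i [set z : pnt | `|z i - (c i)%:R| <= (odd (c i))%:R].
  by apply/seteqP; split=> z h i; [move=> _; exact: h|exact: (h i Logic.I)].
apply: closed_bigI => i _.
have ci : continuous (fun z : pnt => z i) by exact: (@proj_continuous I (fun=> R) i).
apply: (@closed_le R pnt (fun z => `|z i - (c i)%:R|) (fun=> (odd (c i))%:R)).
  by move=> z; exact: (cvg_norm (cvgB (ci z) (cvg_cst _))).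
exact: cst_continuous.
Qed.

(** An affine chart identifies the cell with a standard cube, and on the boundary [f] is tame
    because it is so on each of the finitely many closed facets. *)
Lemma cell_extend c W f : fin_code c -> Ext W (dim c) ->
  (forall c', face c' c -> c' <> c -> tame W (cell c') f) ->
  exists g, tame W (cell c) g /\ forall z, cell_bd c z -> g z = f z.
Proof.
move=> fin ext tf; have [us hs] := oddseqP fin.
pose s := in_tuple (oddseq c).
have sj (j : 'I_(dim c)) : odd (c (tnth s j)) by rewrite -hs mem_tnth.
have sinj (j k : 'I_(dim c)) : tnth s j = tnth s k -> j = k.
  by move=> /(tuple_uniqP s us).
have sP i : odd (c i) -> exists j : 'I_(dim c), tnth s j = i.
  by rewrite -hs => /(@tnthP _ _ s) [j ->]; exists j.
(* Charts between [cube (dim c)] and the cell: only the odd coordinates vary, centred at [c i]. *)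
pose kap (x : 'rV[R]_(dim c)) : pnt := fun i =>
  (c i)%:R + \sum_(j < dim c | tnth s j == i) x ord0 j.
pose rho (z : pnt) : 'rV[R]_(dim c) :=
  \row_j (z (tnth s j) - (c (tnth s j))%:R).
have kapj x j : kap x (tnth s j) - (c (tnth s j))%:R = x ord0 j.
  rewrite /kap addrAC subrr add0r (bigD1 j) //= big1 ?addr0 // => k /andP[/eqP /sinj->].
  by rewrite eqxx.
have kape x i : ~~ odd (c i) -> kap x i = (c i)%:R.
  move=> ne; rewrite /kap big1 ?addr0 // => j /eqP e.
  by move: ne; rewrite -e sj.
have kc A : ctn A kap.
  apply: ctn_ptws => i; apply: ctnD; first exact: ctn_cst.
  by apply: ctn_sum => j _; exact: ctn_coord.
have rc A : ctn A rho.
  apply: ctn_rV => j.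
  apply: (@ctn_eq _ _ _ (fun z : pnt => z (tnth s j) - (c (tnth s j))%:R)).
    by move=> z _; rewrite mxE.
  by apply: ctnD; [exact: ctn_ptws_coord|exact: ctn_cst].
have kapbd x : bdry (dim c) x -> cell_bd c (kap x).
  move=> /bdryP[le1 [j xj]]; split.
    move=> i; case o : (odd (c i)); last by rewrite kape ?o // subrr normr0.
    by have [k <-] := sP _ o; rewrite kapj.
  by exists (tnth s j); [exact: sj|rewrite kapj].
have tbd : tame W (cell_bd c) f.
  pose A (ib : I * bool) := cell (upd c ib.1 (if ib.2 then (c ib.1).+1 else (c ib.1).-1)).
  pose sb := [seq (i, b) | i <- oddseq c, b <- [:: true; false]].
  have sbP i b : ((i, b) \in sb) = odd (c i).
    rewrite -hs; apply/allpairsP/idP => [[[j b'] [/= js _ [-> _]]]//|ic].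
    by exists (i, b); split=> //; case: b.
  have [||_] := @tame_bigU R P adj _ _ W sb A f.
  - by move=> ib _; exact: closed_cell.
  - move=> [i b]; rewrite sbP => o; apply: tf.
      by apply: upd_face => //=; case: b; [right|left].
    move=> e; have := congr1 (fun c => odd (c i)) e; rewrite /upd /= eqxx.
    by case: b {e}; rewrite /= ?o //; case: (c i) o => //= k /negbTE ->.
  apply: tame_sub => // z /cell_bdP[i o zi] /=.
  case: zi => zi; [exists (i, false)|exists (i, true)] => //; by rewrite sbP.
have [g tg gE] := ext (fun x => f (kap x)) (tame_comp (kc _) kapbd tbd).
have krho z : cell c z -> kap (rho z) = z.
  move=> zc; apply/funext => i; case o : (odd (c i)).
    have [j <-] := sP _ o.
    by have := kapj (rho z) j; rewrite /rho mxE => /(addIr _).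
  rewrite kape ?o //; have := zc i; rewrite o normr_le0 subr_eq0 => /eqP ->//.
exists (fun z => g (rho z)); split.
  apply: (tame_comp (B := cube (dim c))) => //.
  move=> z zc; rewrite /cube /=; apply/norm_rV_leP => // j; rewrite mxE.
  by apply: le_trans (zc _) _; rewrite sj.
move=> z [zc [i o zi]]; rewrite gE; first by rewrite krho.
apply/bdryP; split=> [j|]; rewrite ?mxE.
  by apply: le_trans (zc _) _; rewrite sj.
by have [j e] := sP _ o; exists j; rewrite mxE e.
Qed.

End Grid.

(** * Extension from a subcomplex [D] to a complex [K], the values on each cell being confined to a
    carrier *)

Section GridExtension.
Variables (R : realType) (P : choiceType) (adj : P -> P -> Prop) (I : choiceType).
Local Notation tame := (tame (R := R) adj).
Local Notation Ext := (Ext R adj).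
Local Notation pnt := {ptws I -> R}.
Local Notation code := (I -> nat).
Variables (K D : set code) (Vt : code -> set P) (f0 : pnt -> P -> R).
Hypothesis DK : D `<=` K.
Hypothesis K_fin : forall c, K c -> fin_code c.
Hypothesis K_face : forall c c', K c -> face c' c -> K c'.
Hypothesis D_face : forall c c', D c -> face c' c -> D c'.
Hypothesis Vt_mono : forall c c', K c -> face c' c -> Vt c' `<=` Vt c.
Hypothesis f0_tame : forall c, D c -> tame (Vt c) (cell (R := R) c) f0.
Hypothesis K_ext : forall c, K c -> ~ D c -> Ext (Vt c) (dim c).

Let new_cell n z (c : code) := [/\ K c, ~ D c, dim c = n & open_cell (R := R) c z].

Let step_spec f c g := K c -> ~ D c ->
  (forall c', face c' c -> c' <> c -> tame (Vt c') (cell (R := R) c') f) ->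
  tame (Vt c) (cell (R := R) c) g /\ forall z, cell_bd c z -> g z = f z.

(** The choice is made for all maps and cells at once, so that the recursion on the dimension is a
    plain function. *)
Lemma grid_step : exists ext, forall f c, step_spec f c (ext f c).
Proof.
have /choice[ext h] : forall fc : (pnt -> P -> R) * code,
    exists g, step_spec fc.1 fc.2 g.
  move=> [f c] /=.
  have [[Kc [nD tf]]|h] := pselect (K c /\ ~ D c /\
      forall c', face c' c -> c' <> c -> tame (Vt c') (cell (R := R) c') f).
    have [g hg] := cell_extend (K_fin Kc) (K_ext Kc nD)
      (fun c' fc ne => tame_sub (Vt_mono Kc fc) (@subset_refl _ _) (tf c' fc ne)).
    by exists g.
  by exists f => Kc nD tf; case: h.
by exists (fun f c => ext (f, c)) => f c; exact: (h (f, c)).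
Qed.

(** Stage [n] changes the map only on open cells of dimension [n] outside [D], which are disjoint.
    Monotonicity of the carriers lets the faces of a cell feed its own extension problem. *)
Lemma grid_extension : exists f : pnt -> P -> R,
  (forall c, K c -> tame (Vt c) (cell (R := R) c) f) /\
  (forall c z, D c -> cell c z -> f z = f0 z).
Proof.
have [ext extP] := grid_step.
pose c0 : code := fun=> 0%N.
pose next n f z := if pselect (exists c, new_cell n z c)
  then ext f (xget c0 (new_cell n z)) z else f z.
(* [F n] is correct on the cells of dimension less than [n]; hence the successors below. *)
pose fix F n := if n is m.+1 then next m (F m) else f0.
have nextE n f z c : new_cell n z c -> next n f z = ext f c z.
  move=> nc; rewrite /next; case: pselect => [ex|[]]; last by exists c.
  suff -> : xget c0 (new_cell n z) = c by [].
  case: xgetP => [c' _ [_ _ _ o']|/(_ c)]; last by [].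
  by case: nc => _ _ _; exact: open_cell_inj.
have nextE' n f z : (forall c, ~ new_cell n z c) -> next n f z = f z.
  by move=> nc; rewrite /next; case: pselect => // -[c h]; case: (nc c).
have DE n c z : D c -> cell c z -> F n z = f0 z.
  move=> Dc zc; elim: n => // n IH; rewrite /= nextE' // => c' [_ nD _ o'].
  have [c'' fc o''] := open_cell_exists zc; apply: nD.
  by rewrite (open_cell_inj o' o''); exact: D_face fc.
have stable n c z : K c -> (dim c < n)%N -> cell c z -> F n.+1 z = F n z.
  move=> Kc dc zc; rewrite /= nextE' // => c' [_ _ e o'].
  have [c'' fc o''] := open_cell_exists zc.
  have := face_dim (K_fin Kc) fc; rewrite -(open_cell_inj o' o'') e.
  by rewrite leqNgt dc.
have tF n c : K c -> (dim c < n)%N -> tame (Vt c) (cell c) (F n).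
  elim: n c => // n IH c Kc; rewrite ltnS leq_eqVlt => /orP[/eqP dc|dc]; last first.
    apply: (tame_eq (phi := F n)); last exact: IH.
    by move=> z zc; rewrite (stable n c).
  have [Dc|nD] := pselect (D c).
    apply: (tame_eq (phi := f0)); last exact: f0_tame.
    by move=> z zc; rewrite (DE n.+1 c).
  have [tg gE] : tame (Vt c) (cell c) (ext (F n) c) /\
      forall z, cell_bd c z -> ext (F n) c z = F n z.
    apply: extP => // c' fc ne; apply: IH; first exact: K_face fc.
    by rewrite -dc; exact: face_dim_lt (K_fin Kc) fc ne.
  apply: tame_eq tg => z zc.
  have [oc|noc] := pselect (open_cell c z).
    by rewrite /= (nextE _ _ _ c).
  have bc : cell_bd c z.
    split=> //; apply: contrapT => nb; apply: noc; split=> // i oi.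
    rewrite lt_def eq_sym; have := zc i; rewrite oi => ->; rewrite andbT.
    by apply/eqP => e; apply: nb; exists i.
  rewrite gE //= nextE' // => c' [_ _ dc' o'].
  have [c'' fc o''] := open_cell_exists zc.
  have e := open_cell_inj o' o''.
  have ne : c'' <> c by move=> h; apply: noc; rewrite -h.
  by have := face_dim_lt (K_fin Kc) fc ne; rewrite -e dc' dc ltnn.
pose cz (z : pnt) : code := xget c0 [set c | K c /\ open_cell c z].
exists (fun z => F (dim (cz z)).+1 z).
have fE c z : K c -> cell c z -> F (dim (cz z)).+1 z = F (dim c).+1 z.
  move=> Kc zc; have [c' fc o'] := open_cell_exists zc.
  have -> : cz z = c'.
    rewrite /cz; case: xgetP => [c'' _ [_ o'']|/(_ c') h].
      exact: open_cell_inj o'' o'.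
    by exfalso; apply: h; split=> //; exact: K_face fc.
  have [Kc' zc'] : K c' /\ cell c' z by split; [exact: K_face fc|case: o'].
  have := face_dim (K_fin Kc) fc; move: (dim c) => n; elim: n => [|n IH].
    by rewrite leqn0 => /eqP ->.
  rewrite leq_eqVlt => /orP[/eqP -> //|]; rewrite ltnS => le.
  by rewrite IH // (stable n.+1 c').
split=> [c Kc|c z Dc zc].
  apply: (tame_eq (phi := F (dim c).+1)); last exact: tF.
  by move=> z zc; rewrite (fE c).
by rewrite (fE c) //; [exact: DE Dc zc|exact: DK].
Qed.

End GridExtension.

(** * Uniform continuity on compact sets *)

Section UniformContinuity.
Variables (R : realType) (n : nat).

Lemma closed_bdry : closed (bdry n : set 'rV[R]_n).
Proof.
have -> : bdry n = [set x : 'rV[R]_n | `|x| <= 1] `&` [set x | 1 <= `|x|].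
  apply/seteqP; split=> x /=; rewrite /bdry /=; first by move=> ->.
  by move=> [h1 h2]; apply/eqP; rewrite eq_le h1.
by apply: closedI; [exact: closed_norm_le|exact: closed_norm_ge].
Qed.

Lemma compact_bdry : compact (bdry n : set 'rV[R]_n).
Proof.
apply: bounded_closed_compact closed_bdry.
exists 1; split=> // x x1 v vb; apply: ltW; apply: le_lt_trans x1.
by rewrite (vb : _ = _).
Qed.

Lemma uniformly_ctn (A : set 'rV[R]_n) (u : 'rV[R]_n -> R) (e : R) :
  compact A -> ctn A u -> 0 < e ->
  exists2 d, 0 < d & forall x y, A x -> A y -> `|x - y| < d -> `|u x - u y| < e.
Proof.
move=> /compact_near_coveringP cA cu e0.
pose Q (d : R) (x : 'rV[R]_n) := forall y, A x -> A y -> `|x - y| < d -> `|u x - u y| < e.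
have /(cA _ 0^'+) : forall x, A x -> \forall x' \near x & d \near 0^'+, Q d x'.
  move=> x Ax.
  have /cu /(_ (ball (u x) (e / 2))) := Ax.
  move=> /(_ (nbhsx_ballx _ _ (divr_gt0 e0 (ltr0Sn _ 1)))).
  rewrite /within /fmap /= => /nbhs_ballP[r /= r0 hr].
  have r2 : 0 < r / 2 by rewrite divr_gt0.
  exists (ball x (r / 2), [set d | d < r / 2]); first split=> /=.
  - exact: nbhsx_ballx.
  - exact: nbhs_right_lt.
  move=> [x' d] /= [bx' dr] y Ax' Ay xy.
  have h1 : `|u x - u x'| < e / 2.
    apply: hr => //; apply: le_ball bx'; lra.
  have h2 : `|u x - u y| < e / 2.
    apply: hr => //; rewrite -ball_normE /=.
    have := bx'; rewrite -ball_normE /= => bx''.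
    rewrite (_ : x - y = (x - x') + (x' - y)); last by rewrite addrA subrK.
    apply: le_lt_trans (ler_normD _ _) _; lra.
  rewrite (_ : u x' - u y = - (u x - u x') + (u x - u y)); last lra.
  apply: le_lt_trans (ler_normD _ _) _; rewrite normrN; lra.
move=> h.
have hh : \forall d \near (0 : R)^'+, A `<=` Q d /\ 0 < d.
  by apply: filterI => //; exact: nbhs_right_gt.
have [d [hd d0]] := @filter_ex _ _ (at_right_proper_filter (0 : R)) _ hh.
by exists d => // x y Ax; exact: hd.
Qed.

End UniformContinuity.

(** * Adding one vertex *)

Section Push.
Variables (R : realType) (P : choiceType) (adj : P -> P -> Prop).
Hypothesis adj_sym : forall p q, adj p q -> adj q p.
Local Notation tame := (tame (R := R) adj).
Local Notation Ext := (Ext R adj).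
Local Notation extends := (extends adj).

Definition link (V : set P) (y : P) : set P := [set p | [/\ V p, p <> y & adj y p]].

Section GridOnBoundary.
Variables (n m : nat).
Hypothesis m_gt0 : (0 < m)%N.
Local Notation pnt := {ptws 'I_n -> R}.
Local Notation code := ('I_n -> nat).

(** The boundary of [[0, 2m]^n], cut into [m] intervals of length 2 in each direction. *)
Definition bd_code : set code :=
  [set c | (forall i, c i <= m.*2)%N /\ exists i, c i = 0%N \/ c i = m.*2].

Definition to_grid (x : 'rV[R]_n) : pnt := fun i => m%:R * (x ord0 i + 1).

Definition of_grid (z : pnt) : 'rV[R]_n := \row_i (z i / m%:R - 1).

Let m0 : 0 < m%:R :> R. Proof. by rewrite ltr0n. Qed.

Lemma to_gridK x : of_grid (to_grid x) = x.
Proof.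
apply/rowP => i; rewrite mxE /to_grid mulrC mulrA mulVf ?mul1r ?addrK //.
by rewrite gt_eqF.
Qed.

Lemma ctn_to_grid A : ctn A to_grid.
Proof.
apply: ctn_ptws => i; apply: ctnM; first exact: ctn_cst.
by apply: ctnD; [exact: ctn_coord|exact: ctn_cst].
Qed.

Lemma ctn_of_grid A : ctn A of_grid.
Proof.
apply: ctn_rV => i.
apply: (@ctn_eq _ _ _ (fun z : pnt => z i / m%:R - 1)) => [z _|].
  by rewrite mxE.
apply: ctnD; last exact: ctn_cst.
by apply: ctnM; [exact: ctn_ptws_coord|exact: ctn_cst].
Qed.

Lemma ord_code_fin (c : code) : fin_code c.
Proof.
exists [seq i <- enum 'I_n | odd (c i)]; split.
  by rewrite filter_uniq // enum_uniq.
by move=> i; rewrite mem_filter mem_enum andbT.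
Qed.

Lemma bd_code_dim c : bd_code c -> (dim c < n)%N.
Proof.
move=> Kc; have [u h] := oddseqP (ord_code_fin c); case: Kc => _ [i ci].
rewrite -[X in (_ < X)%N]card_ord cardE.
apply: (@uniq_leq_size _ (i :: oddseq c)) => [|j _]; last by rewrite mem_enum.
by rewrite /= u andbT h; case: ci => ->; rewrite //= odd_double.
Qed.

Lemma bd_code_face c c' : bd_code c -> face c' c -> bd_code c'.
Proof.
move=> [le [i ci]] fc; split=> [j|].
  have := le j; case: (fc j) => [-> //|[o [->|->]]]; first by lia.
  rewrite leq_eqVlt => /orP[/eqP e|//].
  by move: o; rewrite e odd_double.
exists i; case: (fc i) => [->//|[]].
by case: ci => ->; rewrite //= odd_double.
Qed.

Lemma bd_code_bdry c z : bd_code c -> cell c z -> bdry n (of_grid z).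
Proof.
move=> [le [i ci]] zc; apply/bdryP; split=> [j|].
  rewrite mxE ler_norml.
  have := zc j; rewrite ler_norml => /andP[h1 h2].
  have lj : (c j)%:R + (odd (c j))%:R <= m%:R * 2 :> R.
    rewrite -natrM -natrD ler_nat muln2.
    have := le j; rewrite leq_eqVlt => /orP[/eqP->|]; first by rewrite odd_double addn0.
    by case: (odd _); lia.
  have gj : (odd (c j))%:R <= (c j)%:R :> R by rewrite ler_nat; case: (c j) => // k; case: odd.
  have a1 : 0 <= z j / m%:R by rewrite divr_ge0 ?ler0n //; lra.
  have a2 : z j / m%:R <= 2 by rewrite ler_pdivrMr //; lra.
  by apply/andP; split; lra.
exists i; rewrite mxE.
have : z i = (c i)%:R.
  apply/eqP; rewrite -subr_eq0 -normr_le0; apply: le_trans (zc i) _.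
  by case: ci => ->; rewrite ?odd_double.
case: ci => -> ->; first by rewrite mul0r add0r normrN normr1.
by rewrite -muln2 natrM mulrC mulKf ?gt_eqF // (_ : 2 - 1 = 1 :> R) ?normr1 //; lra.
Qed.

Lemma cell_mesh (c : code) z z' : cell c z -> cell c z' ->
  `|of_grid z - of_grid z'| <= 2 / m%:R.
Proof.
move=> zc zc'; apply/norm_rV_leP => [|j]; first by rewrite divr_ge0 // ltW.
rewrite !mxE (_ : _ - _ = (z j - z' j) / m%:R); last by rewrite mulrBl; lra.
rewrite normrM normfV (gtr0_norm m0) ler_pM2r ?invr_gt0 //.
have := zc j; have := zc' j; have : (odd (c j))%:R <= 1 :> R by case: odd.
by rewrite !ler_norml => h /andP[h1 h2] /andP[h3 h4]; apply/andP; split; lra.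
Qed.

Lemma bd_code_cover x : bdry n x -> exists2 c, bd_code c & cell c (to_grid x).
Proof.
move=> /bdryP[le1 [i0 x0]].
(* The last clause gives a coordinate [1] or [-1] of [x] an extreme even code, which puts the whole
   code in [bd_code]. *)
have ex i : exists k, [/\ (k <= m.*2)%N, `|to_grid x i - k%:R| <= (odd k)%:R &
    `|x ord0 i| = 1 -> k = 0%N \/ k = m.*2].
  have [e1|ne1] := eqVneq (x ord0 i) (-1).
    exists 0%N; split=> //; last by left.
    by rewrite /to_grid e1 addNr mulr0 subr0 normr0.
  have [e2|ne2] := eqVneq (x ord0 i) 1.
    exists m.*2; split=> //; last by right.
    by rewrite /to_grid e2 odd_double -muln2 natrM (_ : _ - _ = 0) ?normr0 //; lra.
  have := le1 i; rewrite ler_norml => /andP[b1 b2].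
  (* The coordinate lies in [[2k, 2k + 2]], the interval with code [2k + 1]. *)
  pose k := Num.truncn (m%:R * (x ord0 i + 1) / 2).
  have t0 : 0 <= m%:R * (x ord0 i + 1) / 2.
    by rewrite divr_ge0 // mulr_ge0 // ?ler0n //; lra.
  have /andP[k1 k2] := truncn_itv t0.
  have km : (k < m)%N.
    rewrite -(ltr_nat R); apply: le_lt_trans k1 _.
    have : x ord0 i < 1 by rewrite lt_def eq_sym ne2.
    move=> x1; rewrite ltr_pdivrMr // ltr_pM2l //; lra.
  exists k.*2.+1; split.
  + by lia.
  + rewrite /= odd_double /= /to_grid.
    have -> : k.*2.+1%:R = k%:R * 2 + 1 :> R by rewrite -natr1 -muln2 natrM.
    rewrite ler_norml.
    have k2' : m%:R * (x ord0 i + 1) / 2 < k%:R + 1.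
      by apply: lt_le_trans k2 _; rewrite -natr1.
    by apply/andP; split; lra.
  + move=> /eqP; rewrite -[X in _ == X]normr1 eqr_norm2 (negbTE ne1) (negbTE ne2).
    by [].
have [c hc] := choice ex; exists c; last by move=> i; case: (hc i).
split=> [i|]; first by case: (hc i).
by exists i0; case: (hc i0) => _ _; apply.
Qed.

Lemma tame_bdry V phi :
  (forall c, bd_code c -> tame V [set x | bdry n x /\ cell c (to_grid x)] phi) ->
  tame V (bdry n) phi.
Proof.
(* Codes bounded by [2m] are listed as finite functions, so that finitely many closed pieces are
   glued. *)
move=> tc; pose cd (g : {ffun 'I_n -> 'I_(m.*2).+1}) : code := fun i => g i.
pose A g : set 'rV[R]_n := [set x | bdry n x /\ cell (cd g) (to_grid x)].
have [||_] := @tame_bigU R P adj _ _ V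
  [seq g <- enum {ffun 'I_n -> 'I_(m.*2).+1} | `[< bd_code (cd g) >]] A phi.
- move=> g _; apply: closedI; first exact: closed_bdry.
  rewrite -[X in closed X]/(to_grid @^-1` cell (cd g)).
  apply: closed_comp => [x _|]; last exact: closed_cell.
  exact: (ctnT_continuous (ctn_to_grid (A := setT))).
- move=> g; rewrite mem_filter => /andP[/asboolP Kg _]; exact: tc.
apply: tame_sub => // x bx.
have [c Kc xc] := bd_code_cover bx.
pose g : {ffun 'I_n -> 'I_(m.*2).+1} := [ffun i => inord (c i)].
have e : cd g = c.
  apply/funext => i; rewrite /cd /g ffunE inordK // ltnS.
  by case: Kc.
exists g; last by rewrite /A /= e.
by rewrite mem_filter mem_enum andbT; apply/asboolP; rewrite e.
Qed.

End GridOnBoundary.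
(* On the boundary of the cube, slide phi to the vertex y where its y-coordinate
   dominates, and away from y elsewhere. The result phi1 is joined to a map psi
   avoiding y: the projection of phi where y does not dominate, extended over the
   remaining cells of a fine grid, of dimension < n, into the link of y. *)
Lemma Ext_push V y n : V y ->
  Ext (V `\ y) n -> (forall j, (j < n)%N -> Ext (link V y) j) -> Ext V n.
Proof.
move=> Vy ext elk phi tp; have [ppt [F hF] pc] := tp.
pose w x := phi x y; pose o x := \sum_(p <- F | p != y) phi x p.
have phi0 x p : bdry n x -> 0 <= phi x p by move=> /ppt[].
have w0 x : bdry n x -> 0 <= w x by exact: phi0.
have o0 x : bdry n x -> 0 <= o x.
  by move=> bx; apply: sumr_ge0 => p _; exact: phi0.
have opos x p : bdry n x -> p != y -> phi x p != 0 -> 0 < o x.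
  move=> bx py fp; rewrite lt_def o0 // andbT.
  have pF : p \in F by exact: hF fp.
  apply/eqP => /eqP; rewrite psumr_eq0 => [/allP /(_ p pF)|q _]; last exact: phi0.
  by rewrite py (negbTE fp).
have wo x : bdry n x -> 0 < w x + o x.
  move=> bx; have [_ _ _ [p fp]] := ppt x bx.
  have [e|py] := eqVneq p y; last first.
    by rewrite ltr_wpDl ?w0 // (opos x p).
  by rewrite ltr_wpDr ?o0 // lt_def w0 // andbT /w -e.
have o_ex x : 0 < o x -> exists2 p, p != y & phi x p != 0.
  move=> ox; apply: contrapT => nex; move: ox; rewrite /o big1 ?ltxx // => p py.
  by apply/eqP; apply: contrapT => /negP fp; apply: nex; exists p.
(* A comparison of the weights of [y] and of the other vertices with values in [[-1, 1]],
   insensitive to the missing normalization. *)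
pose u x := (w x - o x) / (w x + o x).
have wu x : bdry n x -> - 1 < u x -> 0 < w x.
  move=> bx; rewrite /u ltr_pdivlMr ?wo //; have := wo x bx; lra.
have ou x : bdry n x -> u x < 0 -> 0 < o x.
  move=> bx; rewrite /u ltr_pdivrMr ?wo //; have := w0 x bx; lra.
have uw x : bdry n x -> w x = 0 -> u x = - 1.
  move=> bx e; have := wo x bx; rewrite /u e sub0r add0r => ox.
  by rewrite mulNr divff // gt_eqF.
have cw : ctn (bdry n) w by exact: pc.
have co : ctn (bdry n) o by apply: ctn_sum => p _; exact: pc.
have cu : ctn (bdry n) u.
  apply: ctnM; first by apply: ctnD => //; exact: ctnN.
  by apply: ctnV; [move=> x bx; rewrite gt_eqF // wo|exact: ctnD].
(* The grid is chosen so fine that [u] varies by less than [1/2] on a cell. A cell then has [u < 0]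
   throughout, so that the projection away from [y] is defined, or [u > -1/2] throughout, so that
   [y] is in every support. *)
have [d d0 du] := uniformly_ctn (@compact_bdry R n) cu (divr_gt0 ltr01 (ltr0Sn R 1)).
pose m := (Num.truncn (2 / d)).+1.
have m_gt0 : (0 < m)%N by [].
have md : 2 / m%:R < d.
  rewrite ltr_pdivrMr ?ltr0n // mulrC -ltr_pdivrMr //.
  have /andP[_ h] := truncn_itv (divr_ge0 (ler0n R 2) (ltW d0)).
  exact: h.
pose og := @of_grid n m; pose tg := @to_grid n m.
pose D : set ('I_n -> nat) := [set c | bd_code m c /\ forall z, cell c z -> u (og z) < 0].
pose near_y c := forall z, cell c z -> 0 < w (og z).
(* The carrier is the link of [y] as soon as [y] has positive weight on the whole cell. A face
   satisfies this more easily, so carriers shrink on faces. *)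
pose Vt c : set P := [set p | [/\ V p, p <> y & near_y c -> adj y p]].
pose phi' x p := if p == y then 0 else phi x p.
have near_u c z : bd_code m c -> ~ D c -> cell c z -> - (1 / 2) < u (og z).
  move=> Kc nD zc.
  have [z0 [zc0 uz0]] : exists z0, cell c z0 /\ 0 <= u (og z0).
    apply: contrapT => nex; apply: nD; split=> // z' zc'.
    by rewrite ltNge; apply/negP => h; apply: nex; exists z'.
  have : `|u (og z) - u (og z0)| < 1 / 2.
    apply: du; [exact: bd_code_bdry Kc zc|exact: bd_code_bdry Kc zc0|].
    by apply: le_lt_trans md; exact: cell_mesh zc zc0.
  by rewrite ltr_norml => /andP[h _]; lra.
have near_cell c : bd_code m c -> ~ D c -> near_y c.
  move=> Kc nD z zc; apply: wu; first exact: bd_code_bdry Kc zc.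
  by have := near_u c z Kc nD zc; lra.
have [psi [psi_tame psiE]] : exists f : {ptws 'I_n -> R} -> P -> R,
    (forall c, bd_code m c -> tame (Vt c) (cell c) f) /\
    (forall c z, D c -> cell c z -> f z = phi' (og z)).
  apply: (@grid_extension R P adj 'I_n (bd_code m) D Vt (fun z => phi' (og z))).
  - by move=> c [].
  - by move=> c _; exact: ord_code_fin.
  - exact: bd_code_face.
  - move=> c c' [Kc uc] fc; split; first exact: bd_code_face Kc fc.
    by move=> z zc'; apply: uc; exact: cell_face zc'.
  - move=> c c' Kc fc p [Vp py h]; split=> // nc; apply: h => z zc'.
    by apply: nc; exact: cell_face zc'.
  - move=> c [Kc uc]; split.
    + move=> z zc; have bz := bd_code_bdry m_gt0 Kc zc.
      have [f0 fV fc _] := ppt _ bz; split.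
      * by move=> p; rewrite /phi'; case: (_ =P y) => // _; exact: f0.
      * move=> p; rewrite /phi'; case: (_ =P y) => [_|py fp]; first by rewrite eqxx.
        split=> //; first exact: fV.
        by move=> nc; apply: fc => //; rewrite gt_eqF //; exact: nc zc.
      * move=> p q; rewrite /phi'; case: (_ =P y) => [_|_]; first by rewrite eqxx.
        by case: (_ =P y) => [_|_]; [rewrite eqxx|exact: fc].
      * have [p py fp] := o_ex _ (ou _ bz (uc z zc)).
        by exists p; rewrite /phi' (negbTE py).
    + exists F => z p zc; rewrite /phi'; case: (_ =P y) => [_|_ fp]; first by rewrite eqxx.
      by apply: hF fp; exact: bd_code_bdry Kc zc.
    + move=> p; rewrite /phi'; case: (p == y); first exact: ctn_cst.
      apply: (ctn_comp (B := bdry n)) (pc p); first exact: ctn_of_grid.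
      by move=> z; exact: bd_code_bdry.
  - move=> c Kc nD.
    have -> : Vt c = link V y.
      apply/seteqP; split=> p [Vp py h]; split=> //.
      by apply: h; exact: near_cell.
    by apply: elk; exact: bd_code_dim Kc.
(* The cutoff vanishes for [u >= -1/2], so outside [D] only the vertex [y] remains, joined to the
   whole link. Where [w x = 0] one has [u x = -1] and the cutoff is [1/2], so [phi1] never
   vanishes. *)
pose phi1 x p := if p == y then w x else pos (- u x - 1 / 2) * phi x p.
have phi1_supp x p : bdry n x -> phi1 x p != 0 -> phi x p != 0.
  move=> bx; rewrite /phi1; case: (_ =P y) => [-> //|_].
  by apply: contraNneq => ->; rewrite mulr0.
have phi1_tame : tame V (bdry n) phi1.
  split.
  - move=> x bx; have [f0 fV fc [p0 fp0]] := ppt x bx; split.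
    + by move=> p; rewrite /phi1; case: (_ =P y) => _; [exact: w0|rewrite mulr_ge0 ?pos_ge0].
    + by move=> p /(phi1_supp _ _ bx); exact: fV.
    + by move=> p q /(phi1_supp _ _ bx) hp /(phi1_supp _ _ bx); exact: fc.
    + have [e|ne] := eqVneq (w x) 0; last by exists y; rewrite /phi1 eqxx.
      exists p0; rewrite /phi1 ifF; last first.
        by apply/eqP => e0; move: fp0; rewrite e0 -/(w x) e eqxx.
      by rewrite uw // mulf_neq0 // pos_gt0 ?gt_eqF //; lra.
  - by exists F => x p bx /(phi1_supp _ _ bx); exact: hF.
  - move=> p; rewrite /phi1; case: (_ =P y) => // _; apply: ctnM => //.
    by apply: ctn_pos; apply: ctnD; [exact: ctnN|exact: ctn_cst].
have psi_bdry : tame (V `\ y) (bdry n) (fun x => psi (tg x)).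
  apply: (@tame_bdry n m m_gt0) => c Kc.
  apply: (tame_sub (V := Vt c) (B := [set x | bdry n x /\ cell c (tg x)])) => //.
    by move=> p [Vp py _]; split.
  apply: (tame_comp (B := cell c)); first exact: ctn_to_grid.
    by move=> x [].
  exact: psi_tame.
(* Two straight line homotopies, from [phi] to [phi1] and from [phi1] to [psi]. *)
apply: (extends_joined adj_sym (psi := phi1)) => //.
  move=> x bx p q fp /(phi1_supp _ _ bx) fq.
  by have [_ _ fc _] := ppt x bx; exact: fc.
apply: (extends_joined adj_sym (psi := fun x => psi (tg x))) => //.
- by apply: tame_sub psi_bdry => // p [].
- move=> x bx p q fp; have [c Kc xc] := bd_code_cover m_gt0 bx.
  have [Dc|nD] := pselect (D c).
    rewrite (psiE c) // /og to_gridK // /phi'; case: (_ =P y) => [_|_ fq].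
      by rewrite eqxx.
    by have [_ _ fc _] := ppt x bx; apply: fc => //; exact: phi1_supp fp.
  have [/(_ _ xc)[_ psiV _ _] _ _] := psi_tame c Kc.
  move=> /psiV[_ _ /(_ (near_cell c Kc nD)) yq].
  move: fp; rewrite /phi1; case: (_ =P y) => [-> //|_].
  have := near_u c (tg x) Kc nD xc; rewrite /og to_gridK // => ux.
  by rewrite pos_le0 ?mul0r ?eqxx //; lra.
- have [g tgg gE] := ext _ psi_bdry.
  by exists g => //; apply: tame_sub tgg => // p [].
Qed.

End Push.

(** * Adding finitely many vertices in a prescribed order, and closure operators *)

Section OrderedVertices.
Variables (R : realType) (P : choiceType).

Lemma exists_minimal (r : P -> P -> Prop) (s : seq P) :
  (forall p, ~ r p p) -> (forall p q t, r p q -> r q t -> r p t) ->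
  s != [::] -> exists2 y, y \in s & forall b, b \in s -> ~ r b y.
Proof.
move=> irr tr; elim: s => // a [|b s] IH _.
  by exists a => [|c]; rewrite inE // => /eqP->; exact: irr.
have [//|y ys hy] := IH.
have [ray|nray] := pselect (r a y); last first.
  exists y; first by rewrite inE ys orbT.
  by move=> c; rewrite inE => /orP[/eqP->|/hy].
exists a; first by rewrite inE eqxx.
move=> c; rewrite inE => /orP[/eqP->|cs rca]; first exact: irr.
exact: hy cs (tr _ _ _ rca ray).
Qed.

Section AddVertices.
Variables (adj : P -> P -> Prop) (r : P -> P -> Prop).
Hypotheses (adj_sym : forall p q, adj p q -> adj q p).
Hypotheses (r_irr : forall p, ~ r p p) (r_trans : forall p q t, r p q -> r q t -> r p t).

(** A tame map meets only a finite set [B] of new vertices. The [r]-minimal one is added last, so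
    its link is taken in [J] together with elements of [B] that do not precede it. *)
Lemma Ext_add_vertices (J V : set P) n : J `<=` V -> Ext R adj J n ->
  (forall y (B : seq P) j, V y -> ~ J y -> (forall b, b \in B -> V b /\ ~ J b) ->
     (forall b, b \in B -> ~ r b y) -> (j < n)%N ->
     Ext R adj (link adj (J `|` [set` B]) y) j) ->
  Ext R adj V n.
Proof.
move=> JV eJ elk.
have eB k (B : seq P) : (size B <= k)%N -> (forall b, b \in B -> V b /\ ~ J b) ->
    Ext R adj (J `|` [set` B]) n.
  elim: k B => [|k IH] B.
    rewrite leqn0 size_eq0 => /eqP-> _.
    by rewrite (_ : [set` [::]] = set0) ?setU0 //; apply/seteqP; split=> x.
  move=> sB hB; have [->|Bn] := eqVneq B [::].
    by rewrite (_ : [set` [::]] = set0) ?setU0 //; apply/seteqP; split=> x.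
  have [y yB ymin] := exists_minimal r_irr r_trans Bn.
  have [Vy nJy] := hB y yB.
  apply: (Ext_push adj_sym (y := y)); first by right.
  - have -> : (J `|` [set` B]) `\ y = J `|` [set` [seq b <- B | b != y]].
      apply/seteqP; split=> x /=.
        by move=> [[Jx|xB] xy]; [left|right; rewrite /= mem_filter xB andbT; apply/eqP].
      move=> [Jx|]; first by split; [left|move=> e; apply: nJy; rewrite -e].
      by rewrite /= mem_filter => /andP[/eqP xy xB]; split=> //; right.
    apply: IH; last by move=> b; rewrite mem_filter => /andP[_]; exact: hB.
    rewrite -ltnS; apply: leq_trans sB; rewrite size_filter.
    rewrite -(count_predC (pred1 y) B) -[X in (X < _)%N]add0n ltn_add2r.
    by rewrite -has_count; apply/hasP; exists y => //=.
  - by move=> j jn; apply: elk.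
move=> phi tp; have [h1 [F hF] h3] := tp.
pose B := [seq b <- F | `[< V b /\ ~ J b >]].
have hB b : b \in B -> V b /\ ~ J b by rewrite mem_filter => /andP[/asboolP].
have [g tg gE] : extends adj (J `|` [set` B]) phi.
  apply: (eB (size B)) => //; split=> // [x bx|]; last by exists F.
  apply: pt_sub (h1 x bx) => p fp Vp.
  have [Jp|nJp] := pselect (J p); first by left.
  right; rewrite /= mem_filter (hF x) // andbT.
  exact/asboolP.
by exists g => //; apply: tame_sub tg => // p [/JV //|/hB[]].
Qed.

End AddVertices.

Variable lt : P -> P -> Prop.
Hypotheses (lt_irr : forall p, ~ lt p p) (lt_trans : forall p q t, lt p q -> lt q t -> lt p t).

Definition comparable (p q : P) : Prop := [\/ p = q, lt p q | lt q p].
Definition lte (p q : P) : Prop := p = q \/ lt p q.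

Lemma comparable_refl p : comparable p p. Proof. by constructor 1. Qed.

Lemma comparable_sym p q : comparable p q -> comparable q p.
Proof. by case=> [->|h|h]; [constructor 1|constructor 3|constructor 2]. Qed.

Lemma lte_comparable p q : lte p q -> comparable p q.
Proof. by case=> [->|h]; [constructor 1|constructor 2]. Qed.

(* A closure operator g whose values lie above c: first restrict to its fixed
   points, where g c is a cone point, then add the other points from the top
   down; the link of such a point y is a cone over g y. *)
Lemma Ext_closure (V : set P) (g : P -> P) (c : P) n :
  V c -> (forall p, V p -> [/\ V (g p), lte p (g p), g (g p) = g p & lte c (g p)]) ->
  (forall p q, V p -> V q -> lt p q -> lte (g p) (g q)) ->
  Ext R comparable V n.
Proof.
move=> Vc gV gm; pose J := [set p | V p /\ g p = p].
have gJ p : V p -> J (g p) by move=> /gV[].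
have gle p q : V p -> V q -> lte p q -> lte (g p) (g q).
  by move=> Vp Vq [->|/gm]; [left|apply].
have [Vgc _ ggc _] := gV c Vc.
apply: (@Ext_add_vertices comparable (fun p q => lt q p) comparable_sym _ _ J V).
- by move=> p; exact: lt_irr.
- by move=> p q t pq qt; exact: lt_trans qt pq.
- by move=> p [].
- apply: (@Ext_cone R P comparable comparable_refl comparable_sym J (g c) n); first exact: gJ.
  move=> p [Vp gp]; apply: lte_comparable; rewrite -gp; apply: gle => //.
  by rewrite -gp; have [] := gV p Vp.
(* Here [r] is the reversed order, so [B] has no element above [y]. Hence the link above [y]
   consists of fixed points [p], with [g y <= g p = p], and everything below [y] is below [g y]. *)
- move=> y B j Vy nJy hB Bmax jn.
  have [Vgy ygy ggy _] := gV y Vy.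
  have ltygy : lt y (g y) by case: ygy => // e; case: nJy; split.
  apply: (@Ext_cone R P comparable comparable_refl comparable_sym _ (g y) j).
    split; first by left; exact: gJ.
      by move=> e; apply: nJy; split.
    by constructor 2.
  move=> p [JBp py [e|yp|py']]; first by case: py.
  + case: JBp => [[Vp gp]|/Bmax //].
    by apply: lte_comparable; rewrite -gp; apply: gm.
  + by constructor 3; exact: lt_trans ltygy.
Qed.

End OrderedVertices.

(** * Products of subgroups and the induction along a normal chain *)

Section SubgroupPosets.
Variables (R : realType) (T : Type) (mul : T -> T -> T) (one : T) (inv : T -> T).
Hypothesis hG : is_group mul one inv.
Local Notation subgroup := (subgroup mul one inv).
Local Notation lt := (fun A B : set T => A `<` B).
Local Notation Ext := (Ext R (comparable lt)).
Implicit Types (H K L N Y : set T) (Q : set (set T)).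

Let mulA x y z : mul x (mul y z) = mul (mul x y) z. Proof. by case: hG. Qed.
Let mul1x x : mul one x = x. Proof. by case: hG. Qed.
Let mulVx x : mul (inv x) x = one. Proof. by case: hG. Qed.

Lemma mulxV x : mul x (inv x) = one.
Proof.
rewrite -[LHS]mul1x -{1}(mulVx (inv x)) -mulA (mulA (inv x)) mulVx mul1x.
exact: mulVx.
Qed.

Lemma mulx1 x : mul x one = x.
Proof. by rewrite -(mulVx x) mulA mulxV mul1x. Qed.

Lemma mulKx x y : mul (inv x) (mul x y) = y.
Proof. by rewrite mulA mulVx mul1x. Qed.

Lemma mulxKV x y : mul (mul x y) (inv y) = x.
Proof. by rewrite -mulA mulxV mulx1. Qed.

Lemma invM x y : inv (mul x y) = mul (inv y) (inv x).
Proof.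
have e : mul (mul x y) (mul (inv y) (inv x)) = one.
  by rewrite -mulA (mulA y) mulxV mul1x mulxV.
by rewrite -[LHS]mulx1 -e mulKx.
Qed.

Definition setmul H K : set T := [set z | exists h k, [/\ H h, K k & z = mul h k]].

Definition normalized Y N : Prop :=
  forall y x, Y y -> N x -> N (mul (mul (inv y) x) y).

Lemma subset_mull H K : subgroup K -> H `<=` setmul H K.
Proof. by move=> [K1 _ _] h Hh; exists h, one; split=> //; rewrite mulx1. Qed.

Lemma subset_mulr H K : subgroup H -> K `<=` setmul H K.
Proof. by move=> [H1 _ _] k Kk; exists one, k; split=> //; rewrite mul1x. Qed.

Lemma setmul_sub H K L : subgroup L -> H `<=` L -> K `<=` L -> setmul H K `<=` L.
Proof. by move=> [_ LM _] HL KL z [h [k [/HL Lh /KL Lk ->]]]; exact: LM. Qed.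

Lemma setmulS H H' K : H `<=` H' -> setmul H K `<=` setmul H' K.
Proof. by move=> HH z [h [k [/HH Hh Kk ->]]]; exists h, k. Qed.

Lemma setmul_subgroup Y H N : subgroup H -> subgroup N -> H `<=` Y ->
  normalized Y N -> subgroup (setmul H N).
Proof.
move=> [H1 HM HV] [N1 NM NV] HY nN; split.
- by exists one, one; split=> //; rewrite mul1x.
- move=> _ _ [h [n [Hh Nn ->]]] [h' [n' [Hh' Nn' ->]]].
  exists (mul h h'), (mul (mul (mul (inv h') n) h') n'); split.
  + exact: HM.
  + by apply: NM => //; apply: nN => //; exact: HY.
  + rewrite -!mulA; congr (mul _ _); rewrite (mulA h') mulxV mul1x.
    by [].
- move=> _ [h [n [Hh Nn ->]]]; exists (inv h), (mul (mul (inv (inv h)) (inv n)) (inv h)).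
  split; [exact: HV| by apply: nN; [exact/HY/HV|exact: NV]|].
  by rewrite invM !mulA mulxV mul1x.
Qed.

Lemma setmulK H K N : K `<=` N -> subgroup K -> subgroup N ->
  setmul (setmul H K) N = setmul H N.
Proof.
move=> KN sK sN; apply/seteqP; split; last exact/setmulS/subset_mull.
move=> _ [_ [n [[h [k [Hh Kk ->]]] Nn ->]]]; exists h, (mul k n).
by split; [| |rewrite mulA] => //; have [_ NM _] := sN; apply: NM => //; exact: KN.
Qed.

Lemma properset_trans H K L : H `<` K -> K `<` L -> H `<` L.
Proof.
move=> [HK nKH] [KL _]; split; first exact: subset_trans KL.
by move=> LH; apply: nKH; exact: subset_trans LH.
Qed.

Lemma sub_lte H K : H `<=` K -> lte lt H K.
Proof.
move=> HK; have [KH|nKH] := pselect (K `<=` H); last by right.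
by left; apply/seteqP.
Qed.

Lemma proper_neq H K : H `<=` K -> H <> K -> H `<` K.
Proof. by move=> /sub_lte[]. Qed.

Definition below Y : set (set T) :=
  [set H | [/\ subgroup H, H `<=` Y, H <> Y & H <> [set one]]].

Lemma nontrivial_sub H K : subgroup H -> H <> [set one] -> H `<=` K -> K <> [set one].
Proof.
move=> [H1 _ _] Hn HK e; apply: Hn; apply/seteqP; split=> [x /HK|x ->//].
by rewrite e.
Qed.

(* H <= HN >= N is a contraction as soon as HN stays in the poset. *)
Lemma Ext_setmul Y N Q (Z : set (set T)) n : subgroup Y -> subgroup N -> N `<=` Y ->
  normalized Y N -> (forall q, Q q -> Y `<=` q) -> below Y N -> Z N ->
  (forall H, below Y H -> Z H -> setmul H N <> Y /\ Z (setmul H N)) ->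
  Ext ((below Y `&` Z) `|` Q) n.
Proof.
move=> sY sN NY nN YQ bN ZN hZ.
have nQ H : below Y H -> ~ Q H.
  by move=> [_ HY ne _] /YQ YH; apply: ne; apply/seteqP.
have bmul H : below Y H -> Z H -> below Y (setmul H N).
  move=> bH ZH; have [sH HY _ H1] := bH; split.
  - exact: setmul_subgroup nN.
  - exact: setmul_sub.
  - by case: (hZ H).
  - by apply: nontrivial_sub H1 _ => //; exact: subset_mull.
(* The members of [Q] contain [Y], hence [N], so they can be fixed while the condition of lying
   above [N] still holds. *)
pose g H := if pselect (Q H) then H else setmul H N.
have gQ H : Q H -> g H = H by move=> QH; rewrite /g; case: pselect.
have gb H : below Y H -> g H = setmul H N.
  by move=> /nQ nQH; rewrite /g; case: pselect.
apply: (@Ext_closure R (set T) lt _ _ _ g N).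
- by move=> A [_]; apply.
- by move=> A B C; exact: properset_trans.
- by left; split.
- move=> H [[bH ZH]|QH]; last first.
    rewrite !gQ //; split; [by right|by left|by []|].
    by apply: sub_lte; apply: subset_trans NY _; exact: YQ.
  have bHN := bmul H bH ZH; have [_ ZHN] := hZ H bH ZH.
  rewrite gb // gb //; split; first by left.
  + by apply/sub_lte/subset_mull.
  + by apply: setmulK.
  + by apply/sub_lte/subset_mulr; case: bH.
- move=> H K [[bH ZH]|QH] [[bK ZK]|QK] [HK nKH].
  + by rewrite !gb //; apply/sub_lte/setmulS.
  + rewrite gb // gQ //; apply: sub_lte; apply: subset_trans _ (YQ _ QK).
    by case: (bmul H bH ZH).
  + by case: nKH; apply: subset_trans _ (YQ _ QH); case: bK.
  + by rewrite !gQ //; right.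
Qed.

(** Induction on [e] with [Y] and [Q] varying. The link of a complement [y] of [N] is again of this
    form, for a chain with one term less, and is needed only for [j < n]. [Q] may be any family of
    sets containing [Y]. *)
Lemma Ext_normal_chain e Y Q (M : nat -> set T) n : subgroup Y ->
  (forall q, Q q -> Y `<=` q) ->
  (forall i, (i < e)%N -> below Y (M i) /\ normalized Y (M i)) ->
  (forall i, (i.+1 < e)%N -> M i `<` M i.+1) -> (n < e)%N ->
  Ext (below Y `|` Q) n.
Proof.
elim: e Y Q M n => // e IH Y Q M n sY YQ hM Mlt ne.
pose N := M 0%N; have [[sN NY NneY Nne1] nN] := hM 0%N isT.
have NM i : (i < e.+1)%N -> N `<=` M i.
  elim: i => [_ x //|i IHi ie x Nx]; have [MM _] := Mlt i ie.
  by apply: MM; exact: IHi (ltnW ie) x Nx.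
have NltM i : (i < e)%N -> N `<` M i.+1.
  move=> ie; have [MM nMM] := Mlt i ie; split; first exact: NM.
  by move=> h; apply: nMM => x /h; exact: NM (ltnW ie) x.
pose Z : set (set T) := [set H | setmul H N <> Y].
have NN : setmul N N = N.
  by apply/seteqP; split; [exact: setmul_sub|exact: subset_mull].
have bN : below Y N by split.
have eJ : Ext ((below Y `&` Z) `|` Q) n.
  apply: (@Ext_setmul Y N) => //; first by rewrite /Z /= NN.
  by move=> H _ ZH; split=> //; rewrite /Z /= setmulK.
apply: (@Ext_add_vertices R _ (comparable lt) lt (@comparable_sym _ lt) _ _ _ _ _ _ eJ).
- by move=> A [_]; apply.
- by move=> A B C; exact: properset_trans.
- by move=> H [[bH _]|QH]; [left|right].
move=> y B j Vy nJy hB Bmin jn.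
(* Outside the contractible part, [y] supplements [N] in [Y]. *)
have [by' yN] : below Y y /\ setmul y N = Y.
  case: Vy => [by'|Qy]; last by case: nJy; right.
  by split=> //; apply: contrapT => yN; apply: nJy; left.
have [sy yY yneY yne1] := by'.
have yltY : y `<` Y by exact: proper_neq.
pose Q' : set (set T) := [set b | (b \in B \/ Q b) /\ y `<` b].
(* A member [p] of [Z] above [y] would give [pN = Y], since [yN = Y]; nothing of [B] lies below [y],
   and the members of [Q] contain [Y]. So [Z] contributes only below [y], and [B] and [Q] only
   above. *)
have -> : link (comparable lt) ((below Y `&` Z) `|` Q `|` [set` B]) y =
          (below y `&` Z) `|` Q'.
  apply/seteqP; split=> [p [Vp py [e0|yp|py']]|p].
  - by case: py.
  - right; split=> //; case: Vp => [[[[_ pY _ _] Zp]|Qp]|Bp]; [|by right|by left].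
    case: Zp; apply/seteqP; split; first exact: setmul_sub.
    by rewrite -{1}yN; apply: setmulS; case: yp.
  - left; case: Vp => [[[[sp _ _ p1] Zp]|Qp]|Bp]; last by case: (Bmin p Bp).
      by split=> //; split=> //; case: py'.
    by case: yltY => _ []; apply: subset_trans (YQ _ Qp) _; case: py'.
  - move=> [[[sp py pney p1] Zp]|[[Bp|Qp] yp]].
    + have ply : p `<` y by exact: proper_neq.
      split; [|by []|by constructor 3].
      left; left; split=> //; split=> //; first exact: subset_trans yY.
      by move=> e0; case: ply => _ []; rewrite e0.
    + by split; [right|move=> e0; case: yp; rewrite e0|constructor 2].
    + by split; [left; right|move=> e0; case: yp; rewrite e0|constructor 2].
have yQ' q : Q' q -> y `<=` q by move=> [_ []].
pose K := y `&` N.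
have sK : subgroup K.
  have [a1 aM aV] := sy; have [b1 bM bV] := sN; split=> //.
  - by move=> u v [? ?] [? ?]; split; [exact: aM|exact: bM].
  - by move=> u [? ?]; split; [exact: aV|exact: bV].
have KN : K `<=` N by move=> x [].
have Ky : K `<=` y by move=> x [].
(* If [K] is nontrivial, [HK] stays in [Z] because [HKN = HN], and it differs from [y] because
   [yN = Y]; so the link contracts by [H <= HK >= K]. *)
have [K1|Kne1] := pselect (K = [set one]); last first.
  have nK : normalized y K.
    have [_ aM aV] := sy; move=> u x yu [yx Nx]; split.
      by apply: (aM) => //; apply: (aM) => //; exact: aV.
    by apply: nN => //; exact: yY.
  have KNE : setmul K N = N.
    by apply/seteqP; split; [exact: setmul_sub|exact: subset_mulr].
  apply: (@Ext_setmul y K) => //.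
  - split=> // e0; apply: NneY; transitivity (setmul K N); first exact: esym.
    by rewrite e0.
  - by rewrite /Z /= KNE.
  - move=> H [sH Hy _ _] ZH; have e0 : setmul (setmul H K) N = setmul H N.
      exact: setmulK.
    split; last by rewrite /Z /= e0.
    by move=> e1; apply: ZH; rewrite -e0 e1.
have decomp x : Y x -> exists u v, [/\ y u, N v & x = mul u v] by rewrite -yN.
(* Now [y] is a complement: if [p <= y] and [pN = Y], the [N]-part of an element of [y] lies in the
   trivial group [K], whence [p = y]. *)
have -> : below y `&` Z = below y.
  apply/seteqP; split=> [p []//|p bp]; split=> // pN.
  have [sp py pney _] := bp; apply: pney; apply/seteqP; split=> // x yx.
  have : setmul p N x by rewrite pN; exact: yY.
  move=> [h [v [ph Nv xE]]].
  have : K v.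
    split=> //; rewrite -(mulKx h v) -xE.
    by have [_ aM aV] := sy; apply: aM => //; apply: aV; exact: py.
  by rewrite K1 => /= v1; rewrite xE v1 mulx1.
(* Dedekind's law [M = (M /\ y)N] for [N <= M <= Y]; it makes the intersections with [y] nontrivial
   and strictly increasing. *)
have part i x : (i < e)%N -> M i.+1 x -> exists u v, [/\ (M i.+1 `&` y) u, N v & x = mul u v].
  move=> ie Mx; have [[[M1 MM MV] MY _ _] _] := hM i.+1 ie.
  have [u [v [yu Nv xE]]] := decomp x (MY x Mx); exists u, v; split=> //; split=> //.
  rewrite -(mulxKV u v) -xE; apply: MM => //; apply: MV; exact: NM Nv.
apply: (IH y Q' (fun i => M i.+1 `&` y)) => //.
- move=> i ie; have [[sM MY MneY Mne1] nM] := hM i.+1 ie.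
  have [M1 MM MV] := sM; have [a1 aM aV] := sy; split; last first.
    move=> u x yu [Mx yx]; split; first by apply: nM => //; exact: yY.
    by apply: (aM) => //; apply: (aM) => //; exact: aV.
  split.
  + split=> //; first by move=> u v [? ?] [? ?]; split; [exact: MM|exact: aM].
    by move=> u [? ?]; split; [exact: MV|exact: aV].
  + by move=> x [].
  + move=> e0; apply: MneY; apply/seteqP; split=> //.
    rewrite -yN; apply: setmul_sub => //; last exact: NM.
    by rewrite -e0 => x [].
  + move=> e0; have [_ []] := NltM i ie.
    move=> x /(part _ _ ie)[u [v [+ Nv ->]]].
    by rewrite e0 => /= ->; rewrite mul1x.
- move=> i ie; have [MM' nM'] := Mlt i.+1 ie.
  split=> [x [Mx yx]|h]; first by split=> //; exact: MM'.
  apply: nM' => x /(part _ _ ie)[u [v [/h[Mu _] Nv ->]]].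
  have [[[_ MM _] _ _ _] _] := hM i.+1 (ltnW ie).
  by apply: MM => //; exact: (NM i.+1 (ltnW ie) v Nv).
- by apply: leq_trans jn _; rewrite -ltnS.
Qed.

End SubgroupPosets.

(** * Points of the realization as functions on vertices *)

Section RealizationPoints.
Variables (P : choiceType) (V : set P) (lt : P -> P -> Prop).
Hypotheses (lt_irr : forall p, ~ lt p p) (lt_trans : forall p q t, lt p q -> lt q t -> lt p t).
Local Notation R := Rdefinitions.R.
Local Notation adj := (comparable lt).
Local Notation pt := (pt (R := R) adj V).
Local Notation real := (realization V lt).

Lemma chain_inj n (s : 'I_n -> P) : is_chain V lt s -> injective s.
Proof.
move=> [_ h] i j e; apply/val_inj; case: (ltngtP i j) => // ij; exfalso.
  by apply: (@lt_irr (s j)); rewrite -{1}e; exact: h.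
by apply: (@lt_irr (s j)); rewrite -{2}e; exact: h.
Qed.

Lemma bary_at n (s : 'I_n -> P) t i : injective s -> bary s t (s i) = t ord0 i.
Proof.
move=> si; rewrite /bary (bigD1 i) //= big1 ?addr0 => [|j ji].
  by rewrite asboolT.
by rewrite asboolF // => /si e; rewrite e eqxx in ji.
Qed.

Lemma bary_supp n (s : 'I_n -> P) t p : bary s t p != 0 -> exists i, s i = p.
Proof.
move=> h; apply: contrapT => nex; move: h; rewrite /bary big1 ?eqxx // => i _.
by rewrite asboolF // => e; apply: nex; exists i.
Qed.

(** Only vertices with nonzero coordinate contribute, and on them [s] is injective. [N = 1] gives
    the total mass; general [N] is used for [weight]. *)
Lemma bary_sum n (s : 'I_n -> P) (t : 'rV[R]_n) (N : P -> R) (F : seq P) :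
  injective s -> uniq F ->
  (forall p, bary s t p != 0 -> p \in F) ->
  \sum_(p <- F) N p * bary s t p = \sum_i N (s i) * t ord0 i.
Proof.
move=> si uF hF; rewrite /bary.
under eq_bigr => p _ do rewrite mulr_sumr.
rewrite exchange_big /=; apply: eq_bigr => i _.
have [e|ne] := eqVneq (t ord0 i) 0.
  by rewrite big1 ?e ?mulr0 // => p _; case: ifP; rewrite mulr0.
have sF : s i \in F by apply: hF; rewrite bary_at.
rewrite (bigD1_seq (s i)) //= asboolT // big1 ?addr0 // => p pi.
by rewrite asboolF ?mulr0 // => e; rewrite e eqxx in pi.
Qed.

(** Extracting minimal elements sorts a finite clique of the comparability graph into a chain; so
    its flag complex is the order complex. *)
Lemma sort_clique (l : seq P) : (forall p, p \in l -> V p) ->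
  (forall p q, p \in l -> q \in l -> adj p q) ->
  exists n (s : 'I_n -> P), [/\ is_chain V lt s, forall i, s i \in l &
    forall p, p \in l -> exists i, s i = p].
Proof.
have [k] := ubnP (size l); elim: k l => // k IH l sl lV lc.
have [->|ln] := eqVneq l [::].
  by exists 0%N, (fun i : 'I_0 => match notF (ltn_ord i) with end); split=> [|[]//|//]; split=> -[].
have [y yl ymin] := exists_minimal lt_irr lt_trans ln.
pose l' := [seq b <- l | b != y].
have l'l p : p \in l' -> p \in l by rewrite mem_filter => /andP[].
have [|||n [s [[sV slt] sl' ls]]] := IH l'.
- rewrite -ltnS; apply: leq_trans sl; rewrite ltnS size_filter.
  rewrite -(count_predC (pred1 y) l) -[X in (X < _)%N]add0n ltn_add2r.
  by rewrite -has_count; apply/hasP; exists y => //=.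
- by move=> p /l'l; exact: lV.
- by move=> p q /l'l pl /l'l; exact: lc.
pose s1 (i : 'I_n.+1) := if unlift ord0 i is Some j then s j else y.
have s10 : s1 ord0 = y by rewrite /s1 unlift_none.
have s1S j : s1 (lift ord0 j) = s j by rewrite /s1 liftK.
exists n.+1, s1; split.
- split=> [i|i j ij].
    by case: (unliftP ord0 i) => [j ->|->]; rewrite ?s1S ?s10 //; exact: lV.
  case: (unliftP ord0 j) ij => [j' ->|->]; last by rewrite ltn0.
  case: (unliftP ord0 i) => [i' ->|->]; rewrite ?s1S ?s10.
    by rewrite !lift0 ltnS; exact: slt.
  move=> _; have := sl' j'; rewrite mem_filter => /andP[/eqP ne jl].
  by case: (lc _ _ yl jl) => [e|//|/(ymin _ jl)//]; case: ne.
- move=> i; case: (unliftP ord0 i) => [j ->|->]; rewrite ?s1S ?s10 //.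
  exact/l'l/sl'.
- move=> p pl; have [->|py] := eqVneq p y; first by exists ord0.
  have [|i <-] := ls p; first by rewrite mem_filter py.
  by exists (lift ord0 i).
Qed.

Lemma real_pt (x : real) : pt (sval x).
Proof.
case: x => a /= [n [s [t [cs [t0 t1] ->]]]].
have si := chain_inj cs; have [sV slt] := cs.
have bE p : bary s t p != 0 -> exists i, s i = p /\ bary s t p = t ord0 i.
  by move=> /bary_supp[i <-]; exists i; rewrite bary_at.
split.
- by move=> p; apply: sumr_ge0 => i _; case: ifP.
- by move=> p /bE[i [<- _]].
- move=> p q /bE[i [<- _]] /bE[j [<- _]].
  case: (ltngtP i j) => [ij|ji|/val_inj ->].
  + by constructor 2; exact: slt.
  + by constructor 3; exact: slt.
  + by constructor 1.
- apply: contrapT => nex.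
  have : \sum_i t ord0 i = 0.
    apply: big1 => i _; rewrite -(bary_at t i si).
    by apply: contrapT => /eqP h; apply: nex; exists (s i).
  by rewrite t1 => /eqP; rewrite oner_eq0.
Qed.

Lemma real_fin (x : real) : exists F : seq P,
  uniq F /\ forall p, sval x p != 0 -> p \in F.
Proof.
case: x => a /= [n [s [t [cs _ ->]]]].
exists (undup [seq s i | i <- enum 'I_n]); split; first exact: undup_uniq.
move=> p /bary_supp[i <-]; rewrite mem_undup; apply/mapP; exists i => //.
by rewrite mem_enum.
Qed.

Lemma real_sum (x : real) (F : seq P) : uniq F ->
  (forall p, sval x p != 0 -> p \in F) -> \sum_(p <- F) sval x p = 1.
Proof.
case: x => a /= [n [s [t [cs [_ t1] ->]]]] uF hF.
under eq_bigr => p _ do rewrite -[bary s t p]mul1r.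
rewrite (@bary_sum n s t (fun=> 1)) //; last exact: chain_inj.
by rewrite -[RHS]t1; apply: eq_bigr => i _; rewrite mul1r.
Qed.

Lemma bary_coords n (s : 'I_n -> P) (a : P -> R) : injective s ->
  (forall p, a p != 0 -> exists i, s i = p) -> a = bary s (\row_i a (s i)).
Proof.
move=> si h; apply/funext => p.
have [[i <-]|nex] := pselect (exists i, s i = p); first by rewrite bary_at // mxE.
transitivity (0 : R).
  by apply/eqP; apply: contrapT => /negP /h.
by apply/esym/eqP; apply: contrapT => /negP /bary_supp.
Qed.

Lemma coords_simplex n (s : 'I_n -> P) (a : P -> R) (F : seq P) : injective s ->
  (forall p, a p != 0 -> exists i, s i = p) -> (forall p, 0 <= a p) ->
  uniq F -> (forall p, a p != 0 -> p \in F) -> \sum_(p <- F) a p = 1 ->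
  std_simplex (\row_i a (s i)).
Proof.
move=> si h a0 uF hF s1; split=> [i|]; first by rewrite mxE.
rewrite -[RHS]s1; under [RHS]eq_bigr => p _ do rewrite -[a p]mul1r {1}(bary_coords si h).
rewrite (@bary_sum n s _ (fun=> 1)) //; last by move=> p; rewrite -bary_coords //; exact: hF.
by apply: eq_bigr => i _; rewrite mul1r.
Qed.

Lemma pt_real (a : P -> R) (F : seq P) : pt a -> uniq F ->
  (forall p, a p != 0 -> p \in F) -> \sum_(p <- F) a p = 1 ->
  in_realization V lt a.
Proof.
move=> [a0 aV ac _] uF hF s1.
pose l := [seq p <- F | a p != 0].
have [||n [s [cs sl ls]]] := @sort_clique l.
- by move=> p; rewrite mem_filter => /andP[+ _]; exact: aV.
- by move=> p q; rewrite !mem_filter => /andP[ap _] /andP[aq _]; exact: ac.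
have si := chain_inj cs.
have h p : a p != 0 -> exists i, s i = p.
  by move=> ap; apply: ls; rewrite mem_filter ap hF.
exists n, s, (\row_i a (s i)); split=> //; first exact: coords_simplex uF hF s1.
exact: bary_coords.
Qed.

End RealizationPoints.

(** * Real functions near a point and on compact sets *)

Section RealFunctions.
Variables (R : realType) (E : topologicalType) (A : set E) (f : E -> R).
Hypothesis cf : ctn A f.

Lemma near_neq0 x : A x -> f x != 0 -> \forall y \near within A (nbhs x), f y != 0.
Proof.
move=> Ax fx; have nz : nbhs (f x) [set r : R | r != 0].
  by apply: open_nbhs_nbhs; split=> //; exact: open_neq.
exact: (cf Ax nz).
Qed.

Lemma compact_ctn_bounded : compact A -> exists m : nat, forall x, A x -> f x < m%:R.
Proof.
move=> cA; have [M [_ hM]] := compact_bounded (continuous_compact ((ctnP _ _).1 cf) cA).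
exists (Num.truncn (`|M| + 1)).+1 => x Ax.
have h : `|f x| <= `|M| + 1.
  by apply: hM; [have := ler_norm M; lra|exists x].
have /andP[_ k2] := truncn_itv (addr_ge0 (normr_ge0 M) ler01).
by apply: le_lt_trans k2; apply: le_trans h; exact: ler_norm.
Qed.

End RealFunctions.

(** * Tame maps versus continuous maps to the realization *)

Section RealizationMaps.
Variables (P : choiceType) (V : set P) (lt : P -> P -> Prop).
Hypotheses (lt_irr : forall p, ~ lt p p) (lt_trans : forall p q t, lt p q -> lt q t -> lt p t).
Local Notation R := Rdefinitions.R.
Local Notation adj := (comparable lt).
Local Notation tame := (tame (R := R) adj V).
Local Notation real := (realization V lt).

(** On a finite subcomplex the weak topology is that of the coordinates. *)
Lemma real_ctn (E : topologicalType) (A : set E) (f : E -> real) (F : seq P) :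
  (forall x p, A x -> sval (f x) p != 0 -> p \in F) ->
  (forall p, ctn A (fun x => sval (f x) p)) -> ctn A f.
Proof.
move=> hF hc x Ax S nS.
have {nS} [U [oU Ux] US] : exists2 U, open_nbhs (f x) U & U `<=` S.
  by move: nS; rewrite nbhsE.
(* The simplex carrying [f y] varies with [y]. A neighbourhood is found for each possible support, a
   subset of [F] coded by a bit mask, and the finitely many neighbourhoods are intersected. *)
pose supp y (m : (size F).-tuple bool) :=
  forall p, (sval (f y) p != 0) = (p \in mask m F).
have near_m (m : (size F).-tuple bool) :
    \forall y \near within A (nbhs x), A y -> supp y m -> U (f y).
  pose l := mask m F.
  have [[hl1 hl2]|nl] := pselect ((forall p, p \in l -> V p) /\
      (forall p q, p \in l -> q \in l -> adj p q)); last first.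
    apply: nearW => y Ay sy; case: nl; have [_ yV yc _] := real_pt lt_irr (f y).
    by split=> [p|p q]; rewrite -!sy; [exact: yV|exact: yc].
  (* If [l] misses a vertex of [f x], that vertex stays in the support nearby, so the support cannot
     be [l]. Otherwise [f x] and [f y] lie in the common simplex spanned by [l]. *)
  have [hx|nhx] := pselect (forall p, sval (f x) p != 0 -> p \in l); last first.
    have [p [fp pl]] : exists p, sval (f x) p != 0 /\ p \notin l.
      apply: contrapT => nex; apply: nhx => p fp.
      by apply: contrapT => /negP pl; apply: nex; exists p.
    apply: filterS (near_neq0 (hc p) Ax fp) => y /= yp Ay sy.
    by move: pl; rewrite -sy yp.
  have [n [s [cs sl ls]]] := sort_clique lt_irr lt_trans hl1 hl2.
  have si := chain_inj lt_irr cs.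
  have [O [oO hO]] := oU n s cs.
  pose t y : 'rV[R]_n := \row_i sval (f y) (s i).
  have tP y : (forall p, sval (f y) p != 0 -> p \in l) ->
      sval (f y) = bary s (t y) /\ std_simplex (t y).
    move=> hy; have hy' p : sval (f y) p != 0 -> exists i, s i = p by move=> /hy/ls.
    split; first exact: bary_coords.
    have [F' [uF' hF']] := real_fin (f y).
    have [y0 _ _ _] := real_pt lt_irr (f y).
    have s1 := real_sum lt_irr uF' hF'.
    exact: coords_simplex uF' hF' s1.
  have [ex stx] := tP x hx.
  have Ot : nbhs (t x) O.
    by apply: open_nbhs_nbhs; split=> //; apply/hO => //; exists (f x).
  have ct : ctn A t.
    apply: ctn_rV => j; apply: (@ctn_eq _ _ _ (fun y => sval (f y) (s j))) (hc _) => y _.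
    by rewrite mxE.
  have h := ct x Ax _ Ot.
  apply: (@filterS _ (within A (nbhs x)) (within_filter _ _) _ _ _ h) => y /= Oy Ay sy.
  have [|ey sty] := tP y; first by move=> p; rewrite sy.
  have [z [Uz ez]] := (hO _ sty).1 Oy.
  by have <- : z = f y by apply: realization_val_inj; rewrite ez ey.
have h : \forall y \near within A (nbhs x), forall m, A y -> supp y m -> U (f y).
  exact: (@filter_forall _ _ _ _ (within_filter _ _) near_m).
have : \forall y \near within A (nbhs x), S (f y).
  apply: (@filterS _ (nbhs x) _ (fun y => A y -> forall m, A y -> supp y m -> U (f y))
    (fun y => A y -> S (f y)) _ h) => y hy Ay.
  have := hy Ay (map_tuple (fun p => sval (f y) p != 0) (in_tuple F)) Ay.
  move=> hy'; apply/US/hy' => p.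
  rewrite -filter_mask mem_filter.
  by case e : (sval (f y) p != 0) => //=; apply/esym; exact: hF Ay e.
by [].
Qed.

(** Linear on each simplex with vertex values [N]; the weak topology makes it continuous even for
    unbounded [N]. *)
Definition weight (N : P -> R) (x : real) : R :=
  let F := sval (cid (real_fin x)) in \sum_(p <- F) N p * sval x p.

Lemma weight_bary N n (s : 'I_n -> P) t x : is_chain V lt s -> sval x = bary s t ->
  weight N x = \sum_i N (s i) * t ord0 i.
Proof.
move=> cs e; rewrite /weight; case: cid => F /= [uF hF]; rewrite e.
by apply: bary_sum => //; [exact: chain_inj cs|rewrite -e].
Qed.

Lemma weight_continuous N : continuous (weight N).
Proof.
apply/continuousP => W oW; change (realization_open (weight N @^-1` W)).
move=> n s cs.
exists ((fun t : 'rV[R]_n => \sum_i N (s i) * t ord0 i) @^-1` W); split.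
  apply: open_comp oW => t _.
  apply: (ctnT_continuous (f := fun t : 'rV[R]_n => \sum_i N (s i) * t ord0 i)).
  by apply: ctn_sum => i _; apply: ctnM; [exact: ctn_cst|exact: ctn_coord].
move=> t st; split=> [Wt|[x [Wx ex]]].
  exists (exist _ (bary s t) (bary_in cs st)); split=> //.
  by rewrite /preimage /= (weight_bary N cs (t := t)).
by rewrite /preimage /= -(weight_bary N cs ex).
Qed.

Lemma coord_weight p x : sval x p = weight (fun q => (q == p)%:R) x.
Proof.
rewrite /weight; case: cid => F /= [uF hF].
have [e|ne] := eqVneq (sval x p) 0.
  rewrite e big1 // => q _; case: eqVneq => [->|_]; first by rewrite e mulr0.
  by rewrite mul0r.
rewrite (bigD1_seq p) ?hF //= eqxx mul1r big1 ?addr0 // => q qp.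
by rewrite (negbTE qp) mul0r.
Qed.

(** If a compact set met infinitely many vertices, some [weight] would be unbounded on it. *)
Lemma compact_tame (E : topologicalType) (A : set E) (f : E -> real) :
  compact A -> ctn A f -> tame A (fun x => sval (f x)).
Proof.
move=> cA cf; split.
- by move=> x _; exact: (real_pt lt_irr).
- pose U := [set p | exists2 x, A x & sval (f x) p != 0].
  have [fU|] := pselect (finite_set U).
    have [F eF] := (finite_seqP U).1 fU.
    exists F => x p Ax fp; have Up : U p by exists x.
    by move: Up; rewrite eF.
  move=> /infiniteP/card_leP[e0]; exfalso.
  pose nT k : set_type [set: nat] := exist _ k (mem_set (Logic.I : [set: nat] k)).
  pose e k : P := val (e0 (nT k)).
  have eU k : U (e k) by exact: set_mem (valP (e0 (nT k))).
  have einj : injective e.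
    by move=> i j /val_inj /inj; rewrite !inE => /(_ Logic.I Logic.I) [].
  have /choice[xk hxk] : forall k, exists x, A x /\ sval (f x) (e k) != 0.
    by move=> k; have [x Ax fx] := eU k; exists x.
  (* Scaled so that the vertex [e k] alone contributes [k] to the weight of [f (xk k)]. *)
  pose N p := if pselect (exists k, e k = p) is left h
    then (projT1 (cid h))%:R / sval (f (xk (projT1 (cid h)))) p else 0.
  have Ne k : N (e k) = k%:R / sval (f (xk k)) (e k).
    rewrite /N; case: pselect => [h|[]]; last by exists k.
    by case: cid => j /= /einj ->.
  have N0 p : 0 <= N p.
    rewrite /N; case: pselect => // h; rewrite divr_ge0 ?ler0n //.
    by have [+ _ _ _] := real_pt lt_irr (f (xk (projT1 (cid h)))); apply.
  have [k hk] : exists k : nat, forall x, A x -> weight N (f x) < k%:R.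
    apply: compact_ctn_bounded cA.
    apply: (ctn_comp (B := setT)) cf _ _ => //.
    by apply: continuous_ctn; exact: weight_continuous.
  have [_ fk] := hxk k.
  have [y0 _ _ _] := real_pt lt_irr (f (xk k)).
  have /hk : A (xk k) by case: (hxk k).
  apply/negP; rewrite -leNgt.
    rewrite /weight; case: cid => F /= [uF hF].
    rewrite (bigD1_seq (e k)) ?hF //= Ne divfK // lerDl.
    by apply: sumr_ge0 => p _; rewrite mulr_ge0.
- move=> p; apply: (@ctn_eq _ _ _ (fun x => weight (fun q => (q == p)%:R) (f x))).
    by move=> x _; rewrite coord_weight.
  apply: (ctn_comp (B := setT)) cf _ _ => //.
  by apply: continuous_ctn; exact: weight_continuous.
Qed.

(** Undoes an unknown positive scaling; [y0] is a dummy for functions that are not multiples of a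
    point. *)
Definition realize (y0 : real) (a : P -> R) : real :=
  xget y0 [set y | exists2 c, 0 < c & a = (fun p => c * sval y p)].

Lemma realize_scale y0 c y : 0 < c -> realize y0 (fun p => c * sval y p) = y.
Proof.
move=> c0; rewrite /realize; case: xgetP => [y' _ [c' c0' e]|/(_ y) []]; last by exists c.
have [F [uF hF]] := real_fin y; have [F' [uF' hF']] := real_fin y'.
pose G := undup (F ++ F').
have uG : uniq G by exact: undup_uniq.
have s1 : \sum_(p <- G) sval y p = 1.
  by apply: (real_sum lt_irr) => // p /hF; rewrite mem_undup mem_cat => ->.
have s1' : \sum_(p <- G) sval y' p = 1.
  by apply: (real_sum lt_irr) => // p /hF'; rewrite mem_undup mem_cat orbC => ->.
have cc : c = c'.
  rewrite -[c]mulr1 -[c']mulr1 -{1}s1 -s1' !mulr_sumr.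
  by apply: eq_bigr => p _; exact: (congr1 (fun h => h p) e).
apply: realization_val_inj; apply/funext => p.
have := congr1 (fun h => h p) e; rewrite /= cc => /(mulfI _) -> //.
by rewrite gt_eqF.
Qed.

Lemma realize_sval y0 y : realize y0 (sval y) = y.
Proof.
rewrite -[RHS](realize_scale y0 y ltr01); congr (realize _ _).
by apply/funext => p; rewrite mul1r.
Qed.

Lemma realize_ctn (E : topologicalType) (A : set E) (phi : E -> P -> R) (y0 : real) :
  tame A phi -> ctn A (fun x => realize y0 (phi x)).
Proof.
move=> [h1 [F hF] h3].
pose sm x := \sum_(p <- undup F) phi x p.
pose nr x p := phi x p / sm x.
have hF' x p : A x -> phi x p != 0 -> p \in undup F.
  by move=> Ax; rewrite mem_undup; exact: hF.
have sm0 x : A x -> 0 < sm x.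
  move=> Ax; have [f0 _ _ [p fp]] := h1 x Ax.
  rewrite /sm (bigD1_seq p) ?hF' ?undup_uniq //=; last exact: hF' fp.
  by rewrite ltr_wpDr ?sumr_ge0 // lt_def fp f0.
have nr0 x p : A x -> (nr x p != 0) = (phi x p != 0).
  by move=> Ax; rewrite /nr mulf_eq0 negb_or invr_eq0 (gt_eqF (sm0 x Ax)) andbT.
have nrP x : A x -> in_realization V lt (nr x).
  move=> Ax; have [f0 fV fc [q fq]] := h1 x Ax.
  apply: (@pt_real P V lt lt_irr lt_trans (nr x) (undup F)).
  - split=> [p|p|p p'|].
    + exact: (divr_ge0 (f0 p) (ltW (sm0 x Ax))).
    + by rewrite nr0 //; exact: fV.
    + by rewrite !nr0 //; exact: fc.
    + by exists q; rewrite nr0.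
  - exact: undup_uniq.
  - by move=> p; rewrite nr0 //; exact: hF'.
  - by rewrite -mulr_suml divff // gt_eqF // sm0.
pose f x : real := if pselect (A x) is left Ax then exist _ (nr x) (nrP x Ax) else y0.
have fE x : A x -> sval (f x) = nr x by move=> Ax; rewrite /f; case: pselect.
apply: (@ctn_eq _ _ _ f) => [x Ax|].
  rewrite -[LHS](realize_scale y0 (f x) (sm0 x Ax)); congr (realize _ _).
  by apply/funext => p; rewrite fE // /nr mulrC divfK // gt_eqF // sm0.
apply: (real_ctn (F := F)).
  by move=> x p Ax; rewrite fE // nr0 //; exact: hF.
move=> p; apply: (@ctn_eq _ _ _ (fun x => nr x p)) => [x Ax|]; first by rewrite fE.
apply: ctnM; first exact: h3.
by apply: ctnV; [move=> x Ax; rewrite gt_eqF // sm0|apply: ctn_sum].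
Qed.

End RealizationMaps.

(** * From the cube to the round sphere and disk *)

Section RoundSphere.
Variables (R : realType) (k : nat).
Local Notation vec := ('rV[R]_k.+1).

Let sq (x : vec) : R := \sum_(i < k.+1) x ord0 i ^+ 2.

Let sq_ge0 x : 0 <= sq x.
Proof. by apply: sumr_ge0 => i _; exact: sqr_ge0. Qed.

Let sqZ a x : sq (a *: x) = a ^+ 2 * sq x.
Proof. by rewrite /sq mulr_sumr; apply: eq_bigr => i _; rewrite mxE exprMn. Qed.

Let norm_sq x : `|x| ^+ 2 <= sq x.
Proof.
have [->|x0] := eqVneq x 0; first by rewrite normr0 expr0n /= sq_ge0.
have [[i j] e] : exists i, mx_norm x = `|x i.1 i.2|.
  by apply: mx_norm_neq0; rewrite -[mx_norm x]/(`|x|) normr_eq0.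
rewrite (e : `|x| = _) /= (ord1 i) real_normK ?num_real // /sq (bigD1 j) //=.
by rewrite lerDl; apply: sumr_ge0 => l _; exact: sqr_ge0.
Qed.

Let ctn_sq A : ctn A sq.
Proof.
apply: ctn_sum => i _.
by apply: ctnM; exact: ctn_coord.
Qed.

Let sq_norm x : sq x <= k.+1%:R * `|x| ^+ 2.
Proof.
rewrite -[X in X%:R]card_ord -sum1_card natr_sum mulr_suml.
apply: ler_sum => i _; rewrite mul1r -[X in X <= _]real_normK ?num_real //.
by rewrite ler_sqr ?nnegrE //; exact: norm_coord_le.
Qed.

Lemma compact_sphere : compact [set x : vec | \sum_(i < k.+1) x ord0 i ^+ 2 = 1].
Proof.
apply: bounded_closed_compact.
  exists 1; split=> // a a1 x /= x1; apply: ltW; apply: le_lt_trans a1.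
  by rewrite -(@expr_le1 _ 2) //; apply: le_trans (norm_sq x) _; rewrite /sq x1.
rewrite -[X in closed X]/(sq @^-1` [set y | y = 1]).
apply: closed_comp => [x _|]; last exact: closed_eq.
exact: (ctnT_continuous (ctn_sq (A := setT))).
Qed.

Variables (P : choiceType) (adj : P -> P -> Prop).

(* Points of sup norm at most 1/(k+2) lie inside the round sphere: extend over
   this small cube, and radially outside. *)
Lemma Ext_sphere V (phi : vec -> P -> R) : Ext R adj V k.+1 ->
  tame adj V [set x : vec | \sum_(i < k.+1) x ord0 i ^+ 2 = 1] phi ->
  exists Phi : vec -> P -> R, tame adj V setT Phi /\
    forall x : vec, \sum_(i < k.+1) x ord0 i ^+ 2 = 1 -> Phi x = phi x.
Proof.
move=> ext tp; pose h (x : vec) := (Num.sqrt (sq x))^-1 *: x.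
(* For [|x| <= d] the squares sum to at most [(k+2) d^2 = d < 1], so the small cube misses the
   sphere. *)
pose d : R := k.+2%:R^-1.
have d0 : 0 < d by rewrite invr_gt0 ltr0n.
have d1 : d < 1 by rewrite invf_lt1 ?ltr0n // ltr1n.
have sq0 x : 0 < `|x| -> 0 < sq x.
  by move=> x0; apply: lt_le_trans (norm_sq x); rewrite exprn_gt0.
have hS x : 0 < `|x| -> sq (h x) = 1.
  move=> /sq0 x0; rewrite /h sqZ exprVn sqr_sqrtr ?sq_ge0 // mulVf //.
  by rewrite gt_eqF.
have hZ a x : 0 < a -> h (a *: x) = h x.
  move=> a0; rewrite /h sqZ sqrtrM ?sqr_ge0 // sqrtr_sqr gtr0_norm // invfM scalerA.
  by rewrite mulrAC mulVf ?mul1r // gt_eqF.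
have h1 x : sq x = 1 -> h x = x by move=> e; rewrite /h e sqrtr1 invr1 scale1r.
have ch A : (forall x, A x -> 0 < `|x|) -> ctn A h.
  move=> A0; apply: ctn_scale; apply: ctnV.
    by move=> x /A0/sq0 x0; rewrite gt_eqF // sqrtr_gt0.
  apply: (ctn_comp (B := setT) (f := Num.sqrt)) (ctn_sq (A := A)) _ _ => //.
  by apply: continuous_ctn; exact: realfun.sqrt_continuous.
have [g tg gE] := ext (fun x => phi (h x)) (tame_comp (ch (bdry k.+1)
  (fun x bx => eq_ind_r (fun a => 0 < a) ltr01 bx)) (fun x bx => hS x
  (eq_ind_r (fun a => 0 < a) ltr01 bx)) tp).
pose Phi (x : vec) : P -> R := if `|x| <= d then g (d^-1 *: x) else phi (h x).
pose A1 : set vec := [set x | `|x| <= d]; pose A2 : set vec := [set x | d <= `|x|].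
have PhiE x : A2 x -> Phi x = phi (h x).
  move=> dx; rewrite /Phi; case: ifP => // xd.
  have e : `|x| = d by apply/eqP; rewrite eq_le xd.
  rewrite gE; first by rewrite hZ // invr_gt0.
  by rewrite /bdry /= normrZ e normfV gtr0_norm // mulVf // gt_eqF.
exists Phi; split; last first.
  move=> x x1; rewrite PhiE; first by rewrite h1.
  rewrite /A2 /= leNgt; apply/negP => xd.
  have : sq x <= k.+2%:R * d ^+ 2 :> R.
    apply: le_trans (sq_norm x) _; apply: ler_pM => //; first exact: sqr_ge0.
      by rewrite ler_nat.
    by rewrite ler_sqr ?nnegrE // ltW.
  rewrite /sq x1 expr2 mulrA {1}/d mulfV ?pnatr_eq0 // mul1r => /(lt_le_trans d1).
  by rewrite ltxx.
have -> : setT = A1 `|` A2.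
  apply/seteqP; split=> x // _; have [xd|xd] := leP `|x| d; [by left|right; exact: ltW].
apply: tame_setU; [exact: closed_norm_le|exact: closed_norm_ge| |].
  apply: (tame_eq (phi := fun x : vec => g (d^-1 *: x))).
    by move=> x xd; rewrite /Phi ifT.
  apply: (tame_comp (B := cube k.+1)) tg; first by apply: ctn_scale; exact: ctn_cst.
  move=> x; rewrite /A1 /cube /= normrZ normfV gtr0_norm // => xd.
  by rewrite mulrC ler_pdivrMr // mul1r.
apply: (tame_eq (phi := fun x : vec => phi (h x))); first by move=> x /PhiE.
apply: (tame_comp _ _ tp) => [|x dx].
  by apply: ch => x; rewrite /A2 /=; exact: lt_le_trans.
by apply: hS; exact: lt_le_trans dx.
Qed.

End RoundSphere.

(** * Connectivity of the realization *)

Section ConnectedRealization.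
Variables (P : choiceType) (V : set P) (lt : P -> P -> Prop).
Hypotheses (lt_irr : forall p, ~ lt p p) (lt_trans : forall p q t, lt p q -> lt q t -> lt p t).
Local Notation R := Rdefinitions.R.
Local Notation adj := (comparable lt).
Local Notation real := (realization V lt).

Lemma vertex_real p : V p -> exists x : real, sval x = delta R p.
Proof.
move=> Vp; have [h _ _] := @tame_delta R P adj (@comparable_refl _ lt) R V setT p Vp.
have hr : in_realization V lt (delta R p).
  apply: (@pt_real P V lt lt_irr lt_trans (delta R p) [:: p]) => //.
  - exact: h (0 : R) Logic.I.
  - by move=> q /delta_neq0->; rewrite inE.
  - by rewrite big_seq1 /delta eqxx.
by exists (exist _ _ hr).
Qed.

Lemma Ext0_nonempty : Ext R adj V 0 -> exists p, V p.
Proof.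
move=> /(_ (fun _ _ => 0)) [].
  have -> : bdry 0 = set0 :> set 'rV[R]_0.
    by apply/seteqP; split=> x // /bdryP[_ [[]]].
  exact: tame_set0.
move=> g [+ _ _] _ => /(_ 0); rewrite /cube /= normr0 => /(_ ler01).
by move=> [_ gV _ [p /gV Vp]]; exists p.
Qed.

(** The sphere [S^k] bounds a cube of dimension [k + 1], hence the bound [n + 1]; the index 0 yields
    nonemptiness. *)
Lemma Ext_n_connected (n : int) :
  (forall j : nat, (j%:Z <= n + 1)%R -> Ext R adj V j) -> n_connected real n.
Proof.
move=> ext.
have ne : (-1 <= n)%R -> exists y : real, True.
  move=> n1; have [|p Vp] := Ext0_nonempty; first by apply: ext; lia.
  by have [y _] := vertex_real Vp; exists y.
split=> // k kn f /ctnP cf.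
have [y0 _] : exists y : real, True by apply: ne; lia.
have tp := compact_tame lt_irr (@compact_sphere R k) cf.
have [|Phi [tPhi PhiE]] := Ext_sphere _ tp; first by apply: ext; lia.
exists (fun x => realize y0 (Phi x)); split; last first.
  by move=> x xs; rewrite PhiE //; exact: realize_sval.
apply/ctnP; apply: (@ctn_sub _ _ _ setT) => //.
by apply: (realize_ctn lt_irr lt_trans); exact: tPhi.
Qed.

End ConnectedRealization.

(** * The cylinder over the realization as a cubical complex *)

Section Prism.
Variables (R : realType) (P : choiceType) (adj : P -> P -> Prop) (V : set P) (v0 : P).
Hypotheses (adj_refl : forall p, adj p p) (Vv0 : V v0).
Hypothesis ext : forall n, Ext R adj V n.
Local Notation code := (option P -> nat).
Local Notation pnt := {ptws (option P) -> R}.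

(** With [m] the largest coordinate of [a], the rescaled point has some coordinate equal to 2 and
    lies on outer faces of [[0, 2]^s]. The coordinate [None] is the time. *)
Definition prism_pt (a : P -> R) (m t : R) : pnt :=
  fun o => if o is Some p then 2 * a p / m else 2 * t.

(* The simplex s, rescaled to maximal coordinate 2, times the interval [0, 2]. *)
Definition prism n (s : 'I_n -> P) (q : R * 'rV[R]_n) : pnt :=
  prism_pt (fun p => \sum_(i < n) (if `[< s i = p >] then q.2 ord0 i else 0)) `|q.2| q.1.

Definition prism_dom n : set (R * 'rV[R]_n) :=
  [set q : R * 'rV[R]_n | 0 <= q.1 <= 1 /\
    ((forall i, 0 <= q.2 ord0 i) /\ \sum_(i < n) q.2 ord0 i = 1)].

Lemma prism_dom_end (b : bool) n (t : 'rV[R]_n) :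
  (forall i, 0 <= t ord0 i) /\ \sum_(i < n) t ord0 i = 1 -> prism_dom (b%:R, t).
Proof. by move=> ht; split=> //=; case: b; rewrite ?lexx ?ler01. Qed.

(** Cells with all codes at most 2 whose nonzero vertices form a finite clique; a code 2 at some
    vertex says that the maximal coordinate is attained there. *)
Definition prism_code : set code := [set c |
  [/\ forall o, (c o <= 2)%N, exists F : seq P, forall p, c (Some p) != 0%N -> p \in F,
      forall p, c (Some p) != 0%N -> V p,
      forall p q, c (Some p) != 0%N -> c (Some q) != 0%N -> adj p q &
      exists p, c (Some p) = 2%N]].

Let ends : set code := [set c | prism_code c /\ (c None = 0%N \/ c None = 2%N)].

Let face_neq0 (c c' : code) o : face c' c -> c' o != 0%N -> c o != 0%N.
Proof. by move=> fc; case: (fc o) => [->//|[]]; case: (c o). Qed.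

Let prism_code_face c c' : prism_code c -> face c' c -> prism_code c'.
Proof.
move=> [le [F hF] cV cc [p cp]] fc; split.
- move=> o; have := le o; case: (fc o) => [->//|[]].
  by case: (c o) => [|[|[|k]]] //= _ [->|->].
- by exists F => q /(face_neq0 fc); exact: hF.
- by move=> q /(face_neq0 fc); exact: cV.
- by move=> q r /(face_neq0 fc) cq /(face_neq0 fc); exact: cc.
- by exists p; case: (fc (Some p)) => [->//|[]]; rewrite cp.
Qed.

Let prism_code_fin c : prism_code c -> fin_code c.
Proof.
move=> [_ [F hF] _ _ _].
exists [seq o <- undup (None :: [seq Some p | p <- F]) | odd (c o)]; split.
  by rewrite filter_uniq // undup_uniq.
move=> o; rewrite mem_filter mem_undup.
case oc : (odd (c o)) => //=; rewrite inE.
case: o oc => [p|] // oc; rewrite map_f ?orbT //; apply: hF.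
by case: (c (Some p)) oc.
Qed.

(** The identity at time 0 and the constant [v0] at time 2; the threshold 1 only separates these two
    ends. *)
Let start (z : pnt) (p : P) : R := if z None <= 1 then z (Some p) else delta R v0 p.

Let cell_coord (c : code) (z : pnt) p : cell c z -> z (Some p) != 0 -> c (Some p) != 0%N.
Proof.
move=> zc; apply: contra => /eqP e; have := zc (Some p).
by rewrite e subr0 normr_le0.
Qed.

Let start_tame c : ends c -> tame adj V (cell c) start.
Proof.
move=> [Kc [c0|c2]].
  have e z : cell c z -> start z = (fun p => z (Some p)).
    move=> zc; have := zc None; rewrite c0 subr0 normr_le0 /start => /eqP ->.
    by rewrite ler01.
  apply: (tame_eq (phi := fun (z : pnt) p => z (Some p))).
    by move=> z zc; rewrite e.
  have cc (z : pnt) q : cell c z -> z (Some q) != 0 -> c (Some q) != 0%N.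
    exact: cell_coord.
  case: Kc => le [F hF] cV ca [p cp].
  split.
  + move=> z zc; split.
    * move=> q; have := zc (Some q); rewrite ler_norml => /andP[h _].
      have : (odd (c (Some q)))%:R <= (c (Some q))%:R :> R.
        by rewrite ler_nat; case: (c (Some q)) => // k; case: odd.
      by move=> h'; lra.
    * by move=> q /(cc _ _ zc); exact: cV.
    * by move=> q r /(cc _ _ zc) cq /(cc _ _ zc); exact: ca.
    * exists p; have := zc (Some p); rewrite cp /= normr_le0 subr_eq0 => /eqP->.
      by rewrite pnatr_eq0.
  + by exists F => z q zc /(cc _ _ zc); exact: hF.
  + by move=> q; exact: ctn_ptws_coord.
apply: (tame_eq (phi := fun (z : pnt) => delta R v0)); last exact: tame_delta.
move=> z zc; have := zc None; rewrite c2 /= normr_le0 subr_eq0 /start => /eqP->.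
by apply/funext => p; rewrite ifF //; apply/negP; lra.
Qed.

Section OneSimplex.
Variables (n : nat) (s : 'I_n -> P).
Hypotheses (s_inj : injective s) (sV : forall i, V (s i))
  (s_adj : forall i j, adj (s i) (s j)).

Let coordE (t : 'rV[R]_n) i :
  \sum_(j < n) (if `[< s j = s i >] then t ord0 j else 0) = t ord0 i.
Proof.
rewrite (bigD1 i) //= asboolT // big1 ?addr0 // => j ji.
by rewrite asboolF // => /s_inj e; rewrite e eqxx in ji.
Qed.

Let coord0 (t : 'rV[R]_n) p : ~ (exists i, s i = p) ->
  \sum_(j < n) (if `[< s j = p >] then t ord0 j else 0) = 0.
Proof.
by move=> nex; rewrite big1 // => j _; rewrite asboolF // => e; apply: nex; exists j.
Qed.

Let dom_norm (q : R * 'rV[R]_n) : prism_dom q -> 0 < `|q.2|.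
Proof.
move=> [_ [_ t1]]; rewrite normr_gt0; apply/eqP => e; move: t1; rewrite e big1.
  by move/eqP; rewrite eq_sym oner_eq0.
by move=> i _; rewrite mxE.
Qed.

Let ctn_snd (A : set (R * 'rV[R]_n)) (g : 'rV[R]_n -> R) :
  ctn setT g -> ctn A (fun q => g q.2).
Proof.
move=> cg; apply: (@ctn_comp _ _ _ A setT snd g) => //.
by apply: continuous_ctn => q; exact: cvg_snd.
Qed.

Let ctn_prism : ctn (@prism_dom n) (prism s).
Proof.
have c1 A : ctn A (fun q : R * 'rV[R]_n => q.1) by apply: continuous_ctn => q; exact: cvg_fst.
apply: ctn_ptws => -[p|]; rewrite /prism /prism_pt; last by apply: ctnM => //; exact: ctn_cst.
apply: ctnM.
  apply: ctnM; first exact: ctn_cst.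
  apply: ctn_sum => i _; case: `[< s i = p >]; last exact: ctn_cst.
  exact: (ctn_snd (g := fun t : 'rV[R]_n => t ord0 i) (@ctn_coord R n setT i)).
apply: ctnV; first by move=> q /dom_norm h; rewrite gt_eqF.
exact: (ctn_snd (g := fun t : 'rV[R]_n => `|t|) (@ctn_norm R n setT)).
Qed.

Let mcode (m : {ffun 'I_n -> 'I_3}) : code := fun o =>
  if o is Some p then (\sum_(i < n) (if s i == p then m i : nat else 0))%N else 1%N.

Let mcodeE m i : mcode m (Some (s i)) = m i.
Proof.
rewrite /mcode (bigD1 i) //= eqxx big1 ?addn0 // => j ji.
by rewrite (inj_eq s_inj) (negbTE ji).
Qed.

Let mcode0 m p : ~ (exists i, s i = p) -> mcode m (Some p) = 0%N.
Proof.
move=> nex; rewrite /mcode big1 // => j _; case: eqP => // e.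
by case: nex; exists j.
Qed.

Let mcode_ex m p : mcode m (Some p) != 0%N -> exists i, s i = p.
Proof. by move=> h; apply: contrapT => /(mcode0 m) e; rewrite e in h. Qed.

Let mcodeP (m : {ffun 'I_n -> 'I_3}) : (exists i, m i = 2%N :> nat) -> prism_code (mcode m).
Proof.
move=> [i mi]; split.
- move=> [p|] //; have [[j <-]|nex] := pselect (exists i, s i = p).
    by rewrite mcodeE -ltnS.
  by rewrite mcode0.
- exists [seq s j | j <- enum 'I_n] => p /mcode_ex[j <-].
  by rewrite map_f // mem_enum.
- by move=> p /mcode_ex[j <-].
- by move=> p q /mcode_ex[j <-] /mcode_ex[l <-].
- by exists (s i); rewrite mcodeE.
Qed.

(** The points sent to [cell (mcode m)], with the inequalities multiplied by the norm so that no
    division obscures closedness. *)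
Let piece (m : {ffun 'I_n -> 'I_3}) : set (R * 'rV[R]_n) := [set q | prism_dom q /\
  forall i, `|2 * q.2 ord0 i - (m i)%:R * `|q.2| | <= (odd (m i))%:R * `|q.2|].

Let piece_cell m q : piece m q -> cell (mcode m) (prism s q).
Proof.
move=> [dq hq] [p|]; last first.
  by have [/andP[h1 h2] _] := dq; rewrite /= ler_norml; apply/andP; split; lra.
have [[i <-]|nex] := pselect (exists i, s i = p); last first.
  by rewrite mcode0 // /prism /prism_pt (coord0 _ nex) mulr0 mul0r subrr normr0.
rewrite mcodeE /prism /prism_pt coordE.
have q0 := dom_norm dq.
rewrite -(ler_pM2r q0) -{2}(gtr0_norm q0) -normrM mulrBl divfK ?gt_eqF //.
Qed.

Let closed_dom : closed (@prism_dom n).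
Proof.
have -> : @prism_dom n = [set q : R * 'rV[R]_n | 0 <= q.1] `&` [set q : R * 'rV[R]_n | q.1 <= 1] `&`
    ((\bigcap_i [set q : R * 'rV[R]_n | 0 <= q.2 ord0 i]) `&`
     ([set q : R * 'rV[R]_n | \sum_(i < n) q.2 ord0 i <= 1] `&`
      [set q : R * 'rV[R]_n | 1 <= \sum_(i < n) q.2 ord0 i])).
  apply/seteqP; split=> q.
    move=> [/andP[h1 h2] [h3 h4]]; split; first by split.
    by split; [move=> i _; exact: h3|split; rewrite /= h4].
  move=> [[/= h1 h2] [h3 [/= h4 h5]]]; split; first by rewrite h1.
  by split; [move=> i; exact: h3|apply/eqP; rewrite eq_le h4].
have c1 : continuous (fun q : R * 'rV[R]_n => q.1) by move=> q; exact: cvg_fst.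
have c2 i : continuous (fun q : R * 'rV[R]_n => q.2 ord0 i).
  apply: ctnT_continuous.
  exact: (ctn_snd (g := fun t : 'rV[R]_n => t ord0 i) (@ctn_coord R n setT i)).
have cs : continuous (fun q : R * 'rV[R]_n => \sum_(i < n) q.2 ord0 i).
  by apply/ctnT_continuous; apply: ctn_sum => i _; exact: continuous_ctn.
have cc (a : R) : continuous (fun _ : R * 'rV[R]_n => a) by exact: cst_continuous.
apply: closedI; first by apply: closedI; exact: closed_le.
apply: closedI; first by apply: closed_bigI => i _; exact: closed_le.
by apply: closedI; exact: closed_le.
Qed.

Let closed_piece m : closed (piece m).
Proof.
have -> : piece m = @prism_dom n `&` \bigcap_i [set q : R * 'rV[R]_n |
    `|2 * q.2 ord0 i - (m i)%:R * `|q.2| | <= (odd (m i))%:R * `|q.2|].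
  apply/seteqP; split=> q [dq h]; split=> // i; first by move=> _; exact: h.
  exact: (h i Logic.I).
apply: closedI; first exact: closed_dom.
apply: closed_bigI => i _.
have ci : ctn setT (fun q : R * 'rV[R]_n => q.2 ord0 i).
  exact: (ctn_snd (g := fun t : 'rV[R]_n => t ord0 i) (@ctn_coord R n setT i)).
have cn : ctn setT (fun q : R * 'rV[R]_n => `|q.2|).
  exact: (ctn_snd (g := fun t : 'rV[R]_n => `|t|) (@ctn_norm R n setT)).
apply: closed_le; apply: ctnT_continuous; last by apply: ctnM => //; exact: ctn_cst.
apply: ctn_abs; apply: ctnD; first by apply: ctnM => //; exact: ctn_cst.
by apply: ctnN; apply: ctnM => //; exact: ctn_cst.
Qed.

(** Code 2 at the maximal coordinates, 0 at the vanishing ones, and the full interval elsewhere. *)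
Let piece_cover (q : R * 'rV[R]_n) : prism_dom q ->
  exists m : {ffun 'I_n -> 'I_3}, (exists i, m i = 2%N :> nat) /\ piece m q.
Proof.
move=> dq; have q0 := dom_norm dq; have [_ [t0 _]] := dq.
pose m : {ffun 'I_n -> 'I_3} := [ffun i => if q.2 ord0 i == `|q.2| then inord 2
  else if q.2 ord0 i == 0 then inord 0 else inord 1].
exists m; split.
  have [[a i] e] : exists i, mx_norm q.2 = `|q.2 i.1 i.2|.
    by apply: mx_norm_neq0; rewrite -[mx_norm _]/(`|q.2|) gt_eqF.
  exists i; rewrite ffunE ifT ?inordK // eq_sym; apply/eqP.
  by rewrite (e : `|q.2| = _) /= (ord1 a) ger0_norm.
split=> // i; have := norm_coord_le q.2 i; rewrite ger0_norm // => le.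
rewrite ffunE; case: eqVneq => [->|_].
  by rewrite inordK //= mul0r subrr normr0.
case: eqVneq => [->|_].
  by rewrite inordK //= mulr0 !mul0r subrr normr0.
by rewrite inordK //= !mul1r ler_norml; have := t0 i => ti; apply/andP; split; lra.
Qed.

Lemma prism_tame (f : pnt -> P -> R) : (forall c, prism_code c -> tame adj V (cell c) f) ->
  tame adj V (@prism_dom n) (fun q => f (prism s q)).
Proof.
move=> tf.
have [||_] := @tame_bigU R P adj _ _ V
  [seq m : {ffun 'I_n -> 'I_3} <- enum {ffun 'I_n -> 'I_3} | [exists i, m i == 2%N :> nat]] piece
  (fun q => f (prism s q)).
- by move=> m _; exact: closed_piece.
- move=> m; rewrite mem_filter => /andP[/existsP[i /eqP mi] _].
  apply: (tame_comp (B := cell (mcode m))).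
  + by apply: ctn_sub ctn_prism => q [].
  + by move=> q; exact: piece_cell.
  + by apply: tf; apply: mcodeP; exists i.
apply: tame_sub => // q dq; have [m [[i mi] pm]] := piece_cover dq.
exists m => //; rewrite mem_filter mem_enum andbT.
by apply/existsP; exists i; apply/eqP.
Qed.

Lemma prism_end (b : bool) (q : R * 'rV[R]_n) : prism_dom q -> q.1 = b%:R ->
  exists2 c, ends c & cell c (prism s q).
Proof.
move=> dq qb; have [m [mi pm]] := piece_cover dq.
have Kc := mcodeP mi; have zc := piece_cell pm.
pose c : code := fun o => if o is None then b.*2 else mcode m o.
have cb : c None = 0%N \/ c None = 2%N by rewrite /c; case: (b); [right|left].
have fc : face c (mcode m).
  move=> [p|]; first by left.
  by right; split.
exists c; first by split=> //; exact: prism_code_face fc.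
move=> [p|]; first exact: (zc (Some p)).
by rewrite /c odd_double /= qb -muln2 natrM mulrC subrr normr0.
Qed.

End OneSimplex.

Lemma prism_extension : exists f : pnt -> P -> R, forall n (s : 'I_n -> P),
  injective s -> (forall i, V (s i)) -> (forall i j, adj (s i) (s j)) ->
  [/\ tame adj V (@prism_dom n) (fun q => f (prism s q)),
      forall t, prism_dom (0, t) -> f (prism s (0, t)) = (fun p => prism s (0, t) (Some p)) &
      forall t, prism_dom (1, t) -> f (prism s (1, t)) = delta R v0].
Proof.
have [f [tf fE]] : exists f : pnt -> P -> R,
    (forall c, prism_code c -> tame adj V (cell c) f) /\
    (forall c z, ends c -> cell c z -> f z = start z).
  apply: (@grid_extension R P adj _ prism_code ends (fun=> V) start).
  - by move=> c [].
  - exact: prism_code_fin.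
  - exact: prism_code_face.
  - move=> c c' [Kc ce] fc; split; first exact: prism_code_face fc.
    case: (fc None) => [->//|[]].
    by case: ce => ->.
  - by move=> c c' _ _ x.
  - exact: start_tame.
  - by [].
exists f => n s si sV sa; split; first exact: prism_tame.
- move=> t d; have [c ec zc] := prism_end si sV sa (b := false) d erefl.
  rewrite (fE c) //; apply/funext => p.
  by rewrite /start /prism /prism_pt /= mulr0 ler01.
- move=> t d; have [c ec zc] := prism_end si sV sa (b := true) d erefl.
  rewrite (fE c) //; apply/funext => p.
  by rewrite /start /prism /prism_pt /= mulr1 ifF //; apply/negP; lra.
Qed.

End Prism.

(** * The tube lemma and compact time windows *)

Section Tube.
Variable R : realType.

(** [g] is controlled only on [A], so membership in [A] stays a premise of the conclusion. *)
Lemma tube (X E : topologicalType) (K : set R) (A : set (R * E)) (g : R * E -> X)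
    (W : set X) t : compact K -> ctn A g -> open W ->
  (forall a, K a -> A (a, t) /\ W (g (a, t))) ->
  nbhs t [set t' | forall a, K a -> A (a, t') -> W (g (a, t'))].
Proof.
move=> /compact_near_coveringP cK cg oW hK.
apply: (cK E (nbhs t) (fun t' a => A (a, t') -> W (g (a, t'))) _) => a Ka.
have [Aat Wat] := hK a Ka.
have h := cg (a, t) Aat W (open_nbhs_nbhs (conj oW Wat)).
by apply: (@filterS _ (nbhs (a, t)) _ _ _ _ h) => -[b t'] /=.
Qed.

Lemma compact_window (a r : R) : compact [set b : R | 0 <= b <= 1 /\ `|a - b| <= r].
Proof.
have c1 : continuous (fun b : R => b) by move=> b; exact: cvg_id.
have ca : continuous (fun b : R => `|a - b|).
  apply: ctnT_continuous; apply: ctn_abs; apply: ctnD; first exact: ctn_cst.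
  by apply: ctnN; exact: continuous_ctn.
have -> : [set b : R | 0 <= b <= 1 /\ `|a - b| <= r] =
    [set b | 0 <= b] `&` [set b | b <= 1] `&` [set b | `|a - b| <= r].
  by apply/seteqP; split=> b /=; [move=> [/andP[]]|move=> [[-> ->]]].
have cc (c : R) : continuous (fun _ : R => c) by exact: cst_continuous.
have cl : closed ([set b : R | 0 <= b] `&` [set b | b <= 1] `&` [set b | `|a - b| <= r]).
  apply: closedI; last exact: (@closed_le R R (fun b => `|a - b|) (fun=> r) ca (cc r)).
  apply: closedI; first exact: (@closed_le R R (fun=> 0) id (cc 0) c1).
  exact: (@closed_le R R id (fun=> 1) c1 (cc 1)).
apply: (subclosed_compact cl (@segment_compact R 0 1)) => b [[/= h0 h1] _].
by rewrite in_itv /= h0 h1.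
Qed.

Lemma unit_window (X : topologicalType) (h : R -> X) (W : set X) (a : R) :
  ctn [set b : R | 0 <= b <= 1] h -> 0 <= a <= 1 -> open W -> W (h a) ->
  exists2 r, 0 < r & forall b, 0 <= b <= 1 -> `|a - b| < r -> W (h b).
Proof.
move=> ch a01 oW Wa.
have /nbhs_ballP[r /= r0 hr] := ch a a01 W (open_nbhs_nbhs (conj oW Wa)).
by exists r => // b b01 ab; apply: (hr b) => //; rewrite -ball_normE.
Qed.

Lemma near_window (a r : R) : 0 < r -> nbhs a [set b | `|a - b| < r].
Proof. by move=> r0; apply/nbhs_ballP; exists r => // b; rewrite -ball_normE. Qed.

Lemma ctn_pair_left (n : nat) (A : set R) (t : 'rV[R]_n) :
  ctn A (fun a : R => (a, t)).
Proof.
apply: continuous_ctn => a B [[/= B1 B2] [nB1 nB2] BB].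
apply: (@filterS _ (nbhs a) _ B1) => // b B1b.
by apply: BB; split=> //; exact: nbhs_singleton.
Qed.

End Tube.

(** * Contractibility of the realization *)

Section Whitehead.
Variables (P : choiceType) (V : set P) (lt : P -> P -> Prop).
Hypotheses (lt_irr : forall p, ~ lt p p) (lt_trans : forall p q t, lt p q -> lt q t -> lt p t).
Local Notation R := Rdefinitions.R.
Local Notation adj := (comparable lt).
Local Notation real := (realization V lt).

(** The largest coordinate, defined without reference to a simplex so that [H] is globally defined;
    on each simplex it is the sup norm. *)
Let mx (x : real) : R := xget 0 [set m | (forall p, sval x p <= m) /\ exists p, sval x p = m].

Let mx_bary (x : real) n (s : 'I_n -> P) (t : 'rV[R]_n) :
  is_chain V lt s -> std_simplex t -> sval x = bary s t -> mx x = `|t|.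
Proof.
move=> cs [t0 t1] e; have si := chain_inj lt_irr cs.
have le p : sval x p <= `|t|.
  rewrite e; have [[i <-]|nex] := pselect (exists i, s i = p).
    rewrite bary_at //; apply: le_trans (ler_norm _) _; exact: norm_coord_le.
  have [->|/bary_supp//] := eqVneq (bary s t p) 0.
  exact: normr_ge0.
have [p ep] : exists p, sval x p = `|t|.
  have tn : `|t| != 0.
    rewrite normr_eq0; apply/eqP => e0; move: t1; rewrite e0 big1.
      by move/eqP; rewrite eq_sym oner_eq0.
    by move=> i _; rewrite mxE.
  have [[a i] ei] := mx_norm_neq0 tn.
  exists (s i); rewrite e bary_at // (ei : `|t| = _) /= (ord1 a) ger0_norm //.
rewrite /mx; case: xgetP => [m _ [hm [q eq]]|/(_ `|t|) []]; last by split=> //; exists p.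
by apply/eqP; rewrite eq_le -{1}eq le -ep hm.
Qed.

(* Whitehead: contract the cells of the cylinder one after the other; the
   cylinder carries the weak topology because the interval is compact. *)
Lemma Ext_contractible : (forall n, Ext R adj V n) -> contractible real.
Proof.
move=> ext; have [v0 Vv0] := Ext0_nonempty (ext 0%N).
have [y1 y1E] := vertex_real lt_irr lt_trans Vv0.
have [f hf] := prism_extension (@comparable_refl _ lt) Vv0 ext.
pose H (q : real * R) : real := realize y1 (f (prism_pt (sval q.1) (mx q.1) q.2)).
pose G n (s : 'I_n -> P) (q : R * 'rV[R]_n) : real := realize y1 (f (prism s q)).
have chain_adj n (s : 'I_n -> P) : is_chain V lt s -> forall i j, adj (s i) (s j).
  move=> [_ h] i j; case: (ltngtP i j) => [ij|ji|/val_inj ->].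
  - by constructor 2; exact: h.
  - by constructor 3; exact: h.
  - by constructor 1.
have hfs n (s : 'I_n -> P) (cs : is_chain V lt s) :=
  hf n s (chain_inj lt_irr cs) cs.1 (chain_adj n s cs).
have HG (x : real) n (s : 'I_n -> P) t a : is_chain V lt s -> std_simplex t ->
    sval x = bary s t -> H (x, a) = G n s (a, t).
  by move=> cs st e; rewrite /H /G /= e (mx_bary cs st e).
have cG n (s : 'I_n -> P) : is_chain V lt s -> ctn (@prism_dom R n) (G n s).
  by move=> cs; have [ts _ _] := hfs n s cs; exact: realize_ctn.
exists y1, H; split; first last.
- move=> x; have [n [s [t [cs st e]]]] := svalP x.
  rewrite (HG x n s t 1 cs st e) /G; have [_ _ h1] := hfs n s cs.
  by rewrite (h1 t (prism_dom_end true st)) -y1E realize_sval.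
- move=> x; have [n [s [t [cs st e]]]] := svalP x.
  rewrite (HG x n s t 0 cs st e) /G; have [_ h0 _] := hfs n s cs.
  rewrite (h0 t (prism_dom_end false st)).
  have t0 : 0 < `|t|.
    rewrite normr_gt0; apply/eqP => e0; case: st => _; rewrite e0 big1.
      by move/eqP; rewrite eq_sym oner_eq0.
    by move=> i _; rewrite mxE.
  rewrite -[RHS](realize_scale lt_irr y1 x (divr_gt0 (ltr0Sn R 1) t0)).
  congr (realize _ _); apply/funext => p; rewrite /prism /prism_pt /= mulrAC.
  by rewrite e.
apply/ctnP => -[x0 a0] /= a01 S; rewrite nbhsE => -[W [oW W0] WS].
have [n0 [s0 [t0 [cs0 st0 e0]]]] := svalP x0.
have ch0 : ctn [set b : R | 0 <= b <= 1] (fun b => H (x0, b)).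
  apply: (@ctn_eq _ _ _ (fun b => G n0 s0 (b, t0))).
    by move=> b _; rewrite (HG x0 n0 s0 t0 b).
  apply: (@ctn_comp R (R * 'rV[R]_n0)%type real [set b : R | 0 <= b <= 1]
    (@prism_dom R n0) (fun b => (b, t0)) (G n0 s0)) => //.
    exact: ctn_pair_left.
  exact: cG.
have [r r0 hr] := unit_window ch0 a01 oW W0.
(* Half the radius gives a compact window inside the open one, and still a neighbourhood of [a0] in
   the interval. *)
pose K := [set b : R | 0 <= b <= 1 /\ `|a0 - b| <= r / 2].
have cK : compact K by exact: compact_window.
pose U : set real := [set x | forall b, K b -> W (H (x, b))].
have oU : open U.
  change (realization_open U) => n s cs.
  (* The tube lemma makes [B] a neighbourhood of the points of the simplex lying in [U]; its
     interior is the required open set. *)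
  pose B := [set t : 'rV[R]_n | forall a, K a -> @prism_dom R n (a, t) -> W (G n s (a, t))].
  exists (B°); split; first exact: open_interior.
  move=> t st; split=> [/interior_subset Bt|[x [Ux ex]]].
    exists (exist _ (bary s t) (bary_in cs st)); split=> // b Kb.
    rewrite (HG _ n s t b cs st) //; apply: Bt => //.
    by case: Kb.
  apply: (tube (A := @prism_dom R n)) => //; first exact: cG.
  move=> a Ka; split; first by case: Ka.
  by rewrite -(HG x n s t a cs st ex); exact: Ux.
have U0 : U x0.
  by move=> b [b01 ab]; apply: hr => //; lra.
exists (U, [set b : R | `|a0 - b| < r / 2]).
  split=> /=; first exact: open_nbhs_nbhs.
  by apply: near_window; rewrite divr_gt0.
move=> [x b] [/= Ux ab] b01; apply: WS; apply: Ux; split=> //; exact: ltW.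
Qed.

End Whitehead.

(** * Normal series and the main theorem *)

Section NormalSeries.
Variables (T : Type) (mul : T -> T -> T) (one : T) (inv : T -> T).
Hypothesis hG : is_group mul one inv.
Local Notation R := Rdefinitions.R.
Local Notation subgroup := (subgroup mul one inv).
Local Notation normal_subgroup := (normal_subgroup mul one inv).
Local Notation pns := (proper_nontrivial_subgroup mul one inv).
Local Notation lt := (fun A B : set T => A `<` B).

(** A chief series without maximality: such series of every positive length exist when there is no
    chief series. *)
Definition normal_series (d : nat) (N : nat -> set T) : Prop :=
  [/\ N 0%N = [set one], N d = setT,
      forall i, (i <= d)%N -> normal_subgroup (N i) &
      forall i, (i < d)%N -> N i `<` N i.+1].

(** The terms strictly between the two ends form a chain of [d - 1] proper nontrivial normal
    subgroups. *)
Lemma normal_series_Ext d N n : normal_series d N -> (n.+1 < d)%N ->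
  Ext R (comparable lt) pns n.
Proof.
move=> [N0 Nd nN Nlt] nd.
have sT : subgroup setT by split.
have -> : pns = below mul one inv setT `|` set0.
  rewrite setU0; apply/seteqP; split=> H; first by move=> [].
  by move=> [].
apply: (@Ext_normal_chain R T mul one inv hG d.-1 setT set0 (fun i => N i.+1)) => //.
- move=> i id; have id1 : (i.+1 < d)%N by lia.
  have [sN cN] := nN i.+1 (ltnW id1); split; last by move=> g x _; exact: cN.
  split=> // e.
    by have [_] := Nlt i.+1 id1; rewrite e; apply.
  have [|[N1 _ _] _] := nN i; first by lia.
  by have [|_ []] := Nlt i; [lia|rewrite e => x ->].
- by move=> i id; apply: Nlt; lia.
- by lia.
Qed.

(** A failure of maximality supplies a normal subgroup strictly inside some step; it is inserted
    there. *)
Lemma normal_series_refine d N : ~ chief_length mul one inv d ->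
  normal_series d N -> exists N', normal_series d.+1 N'.
Proof.
move=> nc [N0 Nd nN Nlt].
have [i [K [id nK [iK Ki] [nKi nKi1]]]] : exists i K, [/\ (i < d)%N, normal_subgroup K,
    N i `<=` K /\ K `<=` N i.+1 & K <> N i /\ K <> N i.+1].
  apply: contrapT => nex; apply: nc; exists N; split=> // i K id nK iK Ki.
  apply: contrapT => /not_orP h; apply: nex; exists i, K; split=> //.
exists (fun j => if (j <= i)%N then N j else if j == i.+1 then K else N j.-1); split.
- by [].
- have -> : (d.+1 <= i)%N = false by lia.
  by have -> : (d.+1 == i.+1) = false by lia.
- move=> j jd; case: ifP => ji; first by apply: nN; lia.
  by case: ifP => // ji1; apply: nN; lia.
- move=> j jd; have [ji|ij] := leqP j i; last first.
    have -> : (j < i)%N = false by lia.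
    have -> : (j.+1 == i.+1) = false by lia.
    have [->|ne] := eqVneq j i.+1; first exact: proper_neq.
    have -> : j.+1.-1 = j.-1.+1 by lia.
    by apply: Nlt; lia.
  have [->|ne] := eqVneq j i.
    by rewrite ltnn eqxx; apply: proper_neq => // /esym.
  by rewrite ifT; [apply: Nlt|]; lia.
Qed.

Lemma normal_series_exist m : (forall d, ~ chief_length mul one inv d) ->
  exists N, normal_series m.+1 N.
Proof.
move=> nc; elim: m => [|m [N hN]]; last exact: normal_series_refine hN.
have mx1 : forall x, mul x one = x := mulx1 hG.
have [m1x mVx] : (forall x, mul one x = x) /\ (forall x, mul (inv x) x = one).
  by case: hG.
have inv1 : inv one = one by rewrite -[LHS]mx1 mVx.
have n1 : normal_subgroup [set one].
  split; first by split=> // [x y -> ->|x ->] /=; [rewrite mx1|rewrite inv1].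
  by move=> g x ->; rewrite /= mx1 mVx.
have nT : normal_subgroup setT by [].
(* In the trivial group the constant series would be a chief series of length 0. *)
have T1 : [set one] <> setT.
  move=> e; apply: (nc 0%N); exists (fun=> setT); split=> //.
exists (fun i => if i is 0%N then [set one] else setT); split=> //.
- by case.
- by case=> // _; apply: proper_neq.
Qed.

End NormalSeries.

Theorem mainTheorem18 (T : Type) (mul : T -> T -> T) (one : T) (inv : T -> T)
  (hG : is_group mul one inv) :
  (forall d : nat, chief_length mul one inv d ->
     n_connected (subgroup_complex mul one inv) (d%:Z - 3)%R) /\
  ((forall d : nat, ~ chief_length mul one inv d) ->
     contractible (subgroup_complex mul one inv)).
Proof.
have irr (A : set T) : ~ A `<` A by move=> [_]; apply.
have tr (A B C : set T) : A `<` B -> B `<` C -> A `<` C by exact: properset_trans.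
split=> [d [N [N0 Nd nN Nlt _]]|nc].
  apply: (Ext_n_connected irr tr) => j jd.
  (* Here [j <= (d - 3) + 1], that is, [j + 1 < d]. *)
  by apply: (normal_series_Ext hG (d := d) (N := N)); [split|lia].
apply: (Ext_contractible irr tr) => n.
have [N hN] := normal_series_exist hG n.+1 nc.
by apply: (normal_series_Ext hG hN); lia.
Qed.
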